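(* Let $\mathfrak g(\mathcal A)$ be a Clifford Kac--Moody algebra and $\alpha\in\Pi$ a simple root of one of the following types: (1) $\mathfrak{he}(0)$; (2) $\mathfrak{he}(0)^{\Pi}$; (3) $\mathfrak{he}(2)^{\Pi}$; (4) $H_n$ for some $n\ge3$. Then every nonzero pure, even $\alpha$-coroot lies in an even Heisenberg triple contained in $\mathfrak g\langle\alpha\rangle$. In particular, in these cases, $[\mathfrak h_\alpha,\mathfrak g_\beta]=0$ for all simple roots $\beta$.
   Context: Everything is over $\mathbb C$. **Quasi-toral algebras.** A finite-dimensional Lie superalgebra $\mathfrak h$ is quasi-toral if $[\mathfrak h_{\bar 0},\mathfrak h]=0$; put $\mathfrak t=\mathfrak h_{\bar 0}$. All $\mathfrak h$-modules considered are finite-dimensional with $\mathfrak t$ acting semisimply. For $\lambda\in\mathfrak t^*$, $\operatorname{rk}\lambda$ is the rank of the symmetric form $(x,y)\mapsto\lambda([x,y])$ on $\mathfrak h_{\bar 1}$. Let $\omega_{\mathfrak h}$ be the automorphism of $\mathfrak h$ equal to $-1$ on $\mathfrak h_{\bar 0}$ and $\sqrt{-1}$ on $\mathfrak h_{\bar 1}$. For an $\mathfrak h$-module $V$, $V^\vee=\{v^\vee: v\in V\}$ is the same superspace with action $x\cdot v^\vee=(\omega_{\mathfrak h}^{-1}(x)v)^\vee$. **Cartan datum.** A Cartan datum $\mathcal A$ consists of: a finite-dimensional quasi-toral $\mathfrak h$; a linearly independent finite set $\Pi\subseteq\mathfrak t^*$ (simple roots); for each $\alpha\in\pm\Pi$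 an $\mathfrak h$-module $\mathfrak g_\alpha$ on which $\mathfrak t$ acts by $\alpha$; for each $\alpha\in\Pi$ an $\mathfrak h$-module morphism $[-,-]_\alpha:\mathfrak g_\alpha\otimes\mathfrak g_{-\alpha}\to\mathfrak h$ which is nondegenerate (nonzero on $U\otimes\mathfrak g_{-\alpha}$ and on $\mathfrak g_\alpha\otimes U'$ for all nonzero submodules $U,U'$). $\tilde{\mathfrak g}(\mathcal A)$ is the Lie superalgebra generated by $\bigoplus_{\alpha\in\Pi}\mathfrak g_{-\alpha}\oplus\mathfrak h\oplus\bigoplus_{\alpha\in\Pi}\mathfrak g_{\alpha}$ with relations: brackets inside $\mathfrak h$ are those of $\mathfrak h$; $[h,x]=h\cdot x$ for $h\in\mathfrak h$, $x\in\mathfrak g_{\pm\alpha}$; $[x,y]=\delta_{\alpha\beta}[x,y]_\alpha$ for $x\in\mathfrak g_\alpha$, $y\in\mathfrak g_{-\beta}$, $\alpha,\beta\in\Pi$. $\mathfrak g(\mathcal A)$ is the quotient of $\tilde{\mathfrak g}(\mathcal A)$ by its unique maximal ideal meeting $\mathfrak h$ trivially. Put $\mathfrak h_\alpha=[\mathfrak g_\alpha,\mathfrak g_{-\alpha}]\subseteq\mathfrak h$; its elements are the $\alpha$-coroots. An $\alpha$-coroot is pure if it equals $[x,y]$ for nonzero homogeneous $x\in\mathfrak g_\alpha$, $y\in\mathfrak g_{-\alpha}$. $\mathfrak g\langle\alpha\rangle$ is the subalgebra generated by $\mathfrak g_{\alpha}$ and $\mathfrak g_{-\alpha}$. $\mathfrak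 g(\mathcal A)$ is Clifford Kac--Moody if $\mathfrak g_\alpha$ is an irreducible $\mathfrak h$-module for every $\alpha\in\pm\Pi$, and it is integrable: for all $\alpha,\beta\in\pm\Pi$ there is $N$ with $(\operatorname{ad}\mathfrak g_\alpha)^N\mathfrak g_\beta=0$ in $\mathfrak g(\mathcal A)$. **Types.** A simple root $\alpha$ is of Heisenberg type if $[\mathfrak h_\alpha,\mathfrak g_\alpha]=0$. It is of type $\mathfrak{he}(0)$ if it is of Heisenberg type, $\operatorname{rk}\alpha=0$, and $\mathfrak g_{\pm\alpha}$ are purely even (then $\mathfrak g\langle\alpha\rangle$ is the 3-dimensional even Heisenberg algebra); of type $\mathfrak{he}(0)^\Pi$ if $\operatorname{rk}\alpha=0$ and the one-dimensional spaces $\mathfrak g_\alpha,\mathfrak g_{-\alpha}$ have opposite parities; of type $\mathfrak{he}(2)^\Pi$ if it is of Heisenberg type, $\operatorname{rk}\alpha=2$ and $\mathfrak g_{-\alpha}\not\simeq\mathfrak g_\alpha^\vee$ (equivalently $\mathfrak g_{-\alpha}$ is the parity shift of $\mathfrak g_\alpha^\vee$); of type $H_n$ if it is of Heisenberg type and $\operatorname{rk}\alpha=n$. An even Heisenberg triple is a triple of even elements $e,h,f$ spanning a 3-dimensional subalgebra with $[e,f]=h$ and $h$ commuting with $e,f$. *)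

(* Defs.v *)
From HB Require Import structures.
From mathcomp Require Import all_boot all_order all_algebra.
From mathcomp Require Import boolp reals complex.

Set Implicit Arguments.
Unset Strict Implicit.
Unset Printing Implicit Defensive.

Import GRing.Theory Num.Theory.
Local Open Scope ring_scope.

(* A superspace is a vector space with the projector onto its even part along
   its odd part.  Parities are booleans: false is even, true is odd. *)
HB.mixin Record isSuperspace (K : fieldType) V of GRing.Lmodule K V := {
  even_part : V -> V;
  even_part_linear : forall (c : K) x y,
    even_part (c *: x + y) = c *: even_part x + even_part y;
  even_part_idem : forall x, even_part (even_part x) = even_part x
}.

#[short(type="superspaceType")]
HB.structure Definition Superspace (K : fieldType) :=
  {V of GRing.Lmodule K V & isSuperspace K V}.

#[short(type="finSuperspaceType")]
HB.structure Definition FinSuperspace (K : fieldType) :=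
  {V of Superspace K V & Vector K V}.

Definition spart (K : fieldType) (V : superspaceType K) (p : bool) (x : V) : V :=
  if p then x - even_part x else even_part x.

Definition homog (K : fieldType) (V : superspaceType K) (p : bool) (x : V) : Prop :=
  spart p x = x.

HB.mixin Record isLieSuper (K : fieldType) L of Superspace K L := {
  lbr : L -> L -> L;
  lbr_linearl : forall (c : K) x y z,
    lbr (c *: x + y) z = c *: lbr x z + lbr y z;
  lbr_linearr : forall (c : K) x y z,
    lbr x (c *: y + z) = c *: lbr x y + lbr x z;
  lbr_homog : forall p q x y,
    homog p x -> homog q y -> homog (p (+) q) (lbr x y);
  lbr_anti : forall p q x y, homog p x -> homog q y ->
    lbr x y = - ((-1) ^+ (p && q) *: lbr y x);
  lbr_jacobi : forall p q x y z, homog p x -> homog q y ->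
    lbr x (lbr y z) = lbr (lbr x y) z + (-1) ^+ (p && q) *: lbr y (lbr x z)
}.

#[short(type="lieSuperType")]
HB.structure Definition LieSuper (K : fieldType) :=
  {L of Superspace K L & isLieSuper K L}.

#[short(type="finLieSuperType")]
HB.structure Definition FinLieSuper (K : fieldType) :=
  {L of LieSuper K L & Vector K L}.

Arguments lbr_homog {K s p q x y}.
Arguments lbr_anti {K s p q x y}.
Arguments lbr_jacobi {K s p q x y} z.

HB.instance Definition _ (K : fieldType) (V : superspaceType K) :=
  GRing.isLinear.Build K V V _ (@even_part K V) even_part_linear.

Section LieSuperTheory.
Context (K : fieldType).

Lemma even_partD (V : superspaceType K) (x y : V) :
  even_part (x + y) = even_part x + even_part y.
Proof. by rewrite -[x in LHS]scale1r even_part_linear scale1r. Qed.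

Lemma even_part0 (V : superspaceType K) : even_part (0 : V) = 0.
Proof.
have := even_partD (0 : V) 0; rewrite addr0 => /eqP.
by rewrite -subr_eq0 opprD addNKr oppr_eq0 => /eqP.
Qed.

Lemma even_partZ (V : superspaceType K) c (x : V) :
  even_part (c *: x) = c *: even_part x.
Proof. by rewrite -[_ *: x]addr0 even_part_linear even_part0 addr0. Qed.

Lemma even_partB (V : superspaceType K) (x y : V) :
  even_part (x - y) = even_part x - even_part y.
Proof. by rewrite even_partD -scaleN1r even_partZ scaleN1r. Qed.

Lemma spart_linear (V : superspaceType K) p c (x y : V) :
  spart p (c *: x + y) = c *: spart p x + spart p y.
Proof.
by case: p; rewrite /= /spart even_part_linear // scalerBr opprD addrACA.
Qed.

Lemma spart_homog (V : superspaceType K) p (x : V) : homog p (spart p x).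
Proof.
by case: p; rewrite /homog /spart /= ?even_partB !even_part_idem // subrr subr0.
Qed.

Lemma spartD (V : superspaceType K) (x : V) : x = spart false x + spart true x.
Proof. by rewrite /spart addrC subrK. Qed.

Lemma homogZ (V : superspaceType K) p c (x : V) : homog p x -> homog p (c *: x).
Proof.
by rewrite /homog => hx; case: p hx;
  rewrite /spart /= even_partZ -?scalerBr => ->.
Qed.

Lemma lbr0r (L : lieSuperType K) (x : L) : lbr x 0 = 0.
Proof.
have /eqP := lbr_linearr 1 x 0 0; rewrite scale1r addr0 scale1r.
by rewrite -subr_eq0 opprD addNKr oppr_eq0 => /eqP.
Qed.

Lemma lbr0l (L : lieSuperType K) (x : L) : lbr 0 x = 0.
Proof.
have /eqP := lbr_linearl 1 0 0 x; rewrite scale1r addr0 scale1r.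
by rewrite -subr_eq0 opprD addNKr oppr_eq0 => /eqP.
Qed.

Lemma lbrDl (L : lieSuperType K) (x y z : L) : lbr (x + y) z = lbr x z + lbr y z.
Proof. by rewrite -[x in LHS]scale1r lbr_linearl scale1r. Qed.

Lemma lbrDr (L : lieSuperType K) (x y z : L) : lbr x (y + z) = lbr x y + lbr x z.
Proof. by rewrite -[y in LHS]scale1r lbr_linearr scale1r. Qed.

Lemma lbrZl (L : lieSuperType K) c (x y : L) : lbr (c *: x) y = c *: lbr x y.
Proof. by rewrite -[_ *: x]addr0 lbr_linearl lbr0l addr0. Qed.

Lemma lbrZr (L : lieSuperType K) c (x y : L) : lbr x (c *: y) = c *: lbr x y.
Proof. by rewrite -[_ *: y]addr0 lbr_linearr lbr0r addr0. Qed.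

End LieSuperTheory.

(* Ideals are Z/2-graded; being graded, a left ideal is two-sided. *)
Record ideal (K : fieldType) (L : lieSuperType K) := Ideal {
  ideal_mem :> L -> Prop;
  ideal0 : ideal_mem 0;
  ideal_linear : forall c x y, ideal_mem x -> ideal_mem y -> ideal_mem (c *: x + y);
  ideal_even_part : forall x, ideal_mem x -> ideal_mem (even_part x);
  ideal_lbr : forall x y, ideal_mem y -> ideal_mem (lbr x y)
}.

Section Quotient.
Context (K : fieldType) (L : lieSuperType K) (I : ideal L).

Lemma idealD x y : I x -> I y -> I (x + y).
Proof. by move=> Ix Iy; rewrite -[x]scale1r; apply: ideal_linear. Qed.

Lemma idealZ c x : I x -> I (c *: x).
Proof. by move=> Ix; rewrite -[_ *: _]addr0; apply: ideal_linear => //; apply: ideal0. Qed.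

Lemma idealN x : I x -> I (- x).
Proof. by move=> Ix; rewrite -scaleN1r; apply: idealZ. Qed.

Lemma ideal_lbr_left x y : I x -> I (lbr x y).
Proof.
move=> Ix.
have Ip p : I (spart p x).
  case: p; rewrite /spart; last exact: ideal_even_part.
  by apply: idealD => //; apply/idealN/ideal_even_part.
have Ipq p q : I (lbr (spart p x) (spart q y)).
  rewrite (lbr_anti (spart_homog p x) (spart_homog q y)).
  exact/idealN/idealZ/ideal_lbr.
have Iq q : I (lbr x (spart q y)) by rewrite (spartD x) lbrDl; apply: idealD.
by rewrite (spartD y) lbrDr; apply: idealD.
Qed.

Definition ideal_rel (x y : L) : bool := `[< I (x - y) >].

Lemma ideal_rel_refl : reflexive ideal_rel.
Proof. by move=> x; apply/asboolP; rewrite subrr; apply: ideal0. Qed.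

Lemma ideal_rel_sym : symmetric ideal_rel.
Proof.
move=> x y; apply/asboolP/asboolP => /idealN; by rewrite opprB.
Qed.

Lemma ideal_rel_trans : transitive ideal_rel.
Proof.
move=> y x z /asboolP xy /asboolP yz; apply/asboolP.
by rewrite -(subrK y x) -addrA; apply: idealD.
Qed.

Canonical ideal_equiv :=
  EquivRel ideal_rel ideal_rel_refl ideal_rel_sym ideal_rel_trans.

Definition lquot : Type := {eq_quot ideal_equiv}%qT.
HB.instance Definition _ := Choice.on lquot.

Definition lproj (x : L) : lquot := \pi_({eq_quot ideal_equiv})%qT x.
Definition lrep (a : lquot) : L := repr (a : {eq_quot ideal_equiv}%qT).

Lemma lrepK : cancel lrep lproj. Proof. exact: reprK. Qed.

Lemma lprojP x y : lproj x = lproj y <-> I (x - y).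
Proof.
split=> [/eqquotP/asboolP //|h]; by apply/eqquotP/asboolP.
Qed.

Lemma lrep_proj x : I (lrep (lproj x) - x).
Proof. by apply/lprojP; rewrite lrepK. Qed.

Definition lq_add (a b : lquot) := lproj (lrep a + lrep b).
Definition lq_opp (a : lquot) := lproj (- lrep a).
Definition lq_scale c (a : lquot) := lproj (c *: lrep a).
Definition lq_even (a : lquot) := lproj (even_part (lrep a)).
Definition lq_br (a b : lquot) := lproj (lbr (lrep a) (lrep b)).

Lemma lq_addE x y : lq_add (lproj x) (lproj y) = lproj (x + y).
Proof. by apply/lprojP; rewrite opprD addrACA; apply: idealD; apply: lrep_proj. Qed.

Lemma lq_oppE x : lq_opp (lproj x) = lproj (- x).
Proof. by apply/lprojP; rewrite -opprD; apply/idealN/lrep_proj. Qed.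

Lemma lq_scaleE c x : lq_scale c (lproj x) = lproj (c *: x).
Proof. by apply/lprojP; rewrite -scalerBr; apply/idealZ/lrep_proj. Qed.

Lemma lq_evenE x : lq_even (lproj x) = lproj (even_part x).
Proof. by apply/lprojP; rewrite -even_partB; apply/ideal_even_part/lrep_proj. Qed.

Lemma lq_brE x y : lq_br (lproj x) (lproj y) = lproj (lbr x y).
Proof.
apply/lprojP; set x' := lrep _; set y' := lrep _.
have -> : lbr x' y' - lbr x y = lbr (x' - x) y' + lbr x (y' - y).
  rewrite lbrDl lbrDr -!scaleN1r lbrZl lbrZr !scaleN1r addrA.
  by rewrite addrNK.
by apply: idealD; [apply: ideal_lbr_left|apply: ideal_lbr]; apply: lrep_proj.
Qed.

Lemma lproj_ind (P : lquot -> Prop) : (forall x, P (lproj x)) -> forall a, P a.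
Proof. by move=> h a; rewrite -(lrepK a). Qed.

Lemma lq_addA : associative lq_add.
Proof. by do 3!elim/lproj_ind => ?; rewrite !lq_addE addrA. Qed.
Lemma lq_addC : commutative lq_add.
Proof. by do 2!elim/lproj_ind => ?; rewrite !lq_addE addrC. Qed.
Lemma lq_add0 : left_id (lproj 0) lq_add.
Proof. by elim/lproj_ind => ?; rewrite lq_addE add0r. Qed.
Lemma lq_addN : left_inverse (lproj 0) lq_opp lq_add.
Proof. by elim/lproj_ind => ?; rewrite lq_oppE lq_addE addNr. Qed.

HB.instance Definition _ :=
  GRing.isZmodule.Build lquot lq_addA lq_addC lq_add0 lq_addN.

Lemma lq_scaleA a b v : lq_scale a (lq_scale b v) = lq_scale (a * b) v.
Proof. by elim/lproj_ind: v => ?; rewrite !lq_scaleE scalerA. Qed.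
Lemma lq_scale1 : left_id 1 lq_scale.
Proof. by elim/lproj_ind => ?; rewrite lq_scaleE scale1r. Qed.
Lemma lq_scaleDr : right_distributive lq_scale +%R.
Proof.
move=> c; elim/lproj_ind => x; elim/lproj_ind => y.
by rewrite [_ + _ in LHS]lq_addE !lq_scaleE scalerDr [RHS]lq_addE.
Qed.
Lemma lq_scaleDl v : {morph lq_scale^~ v : a b / a + b}.
Proof.
move=> a b; elim/lproj_ind: v => x; rewrite !lq_scaleE scalerDl.
by rewrite [RHS]lq_addE.
Qed.

HB.instance Definition _ :=
  GRing.Zmodule_isLmodule.Build K lquot lq_scaleA lq_scale1 lq_scaleDr lq_scaleDl.

Lemma lproj_linear c x y : lproj (c *: x + y) = c *: lproj x + lproj y.
Proof. by rewrite -lq_addE -lq_scaleE. Qed.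

Lemma lq_even_linear (c : K) (a b : lquot) :
  lq_even (c *: a + b) = c *: lq_even a + lq_even b.
Proof.
elim/lproj_ind: a => x; elim/lproj_ind: b => y.
by rewrite -lproj_linear !lq_evenE even_part_linear lproj_linear.
Qed.

Lemma lq_even_idem a : lq_even (lq_even a) = lq_even a.
Proof. by elim/lproj_ind: a => x; rewrite !lq_evenE even_part_idem. Qed.

HB.instance Definition _ := isSuperspace.Build K lquot lq_even_linear lq_even_idem.

Lemma lproj_spart p x : spart p (lproj x) = lproj (spart p x).
Proof.
have E y : even_part (lproj y) = lproj (even_part y) by exact: lq_evenE.
case: p; rewrite /spart //= E.
by rewrite addrC -scaleN1r -lproj_linear scaleN1r addrC.
Qed.

Lemma lproj_homog p a : homog p a -> exists2 x, homog p x & a = lproj x.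
Proof.
elim/lproj_ind: a => x; rewrite /homog lproj_spart => <-.
by exists (spart p x) => //; apply: spart_homog.
Qed.

Lemma homog_lproj p x : homog p x -> homog p (lproj x).
Proof. by rewrite /homog lproj_spart => ->. Qed.

Lemma lq_br_linearl (c : K) (x y z : lquot) :
  lq_br (c *: x + y) z = c *: lq_br x z + lq_br y z.
Proof.
elim/lproj_ind: x => x; elim/lproj_ind: y => y; elim/lproj_ind: z => z.
by rewrite -lproj_linear !lq_brE -lproj_linear lbr_linearl.
Qed.

Lemma lq_br_linearr (c : K) (x y z : lquot) :
  lq_br x (c *: y + z) = c *: lq_br x y + lq_br x z.
Proof.
elim/lproj_ind: x => x; elim/lproj_ind: y => y; elim/lproj_ind: z => z.
by rewrite -lproj_linear !lq_brE -lproj_linear lbr_linearr.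
Qed.

Lemma lq_br_homog p q (x y : lquot) :
  homog p x -> homog q y -> homog (p (+) q) (lq_br x y).
Proof.
move=> /lproj_homog[{}x hx ->] /lproj_homog[{}y hy ->].
by rewrite lq_brE; apply/homog_lproj/lbr_homog.
Qed.

Lemma lq_br_anti p q (x y : lquot) : homog p x -> homog q y ->
  lq_br x y = - ((-1) ^+ (p && q) *: lq_br y x).
Proof.
move=> /lproj_homog[{}x hx ->] /lproj_homog[{}y hy ->].
rewrite !lq_brE (lbr_anti hx hy).
by rewrite [_ *: _ in RHS]lq_scaleE [RHS]lq_oppE.
Qed.

Lemma lq_br_jacobi p q (x y z : lquot) : homog p x -> homog q y ->
  lq_br x (lq_br y z) =
    lq_br (lq_br x y) z + (-1) ^+ (p && q) *: lq_br y (lq_br x z).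
Proof.
move=> /lproj_homog[{}x hx ->] /lproj_homog[{}y hy ->].
elim/lproj_ind: z => z; rewrite !lq_brE (lbr_jacobi _ hx hy).
by rewrite addrC lproj_linear addrC.
Qed.

HB.instance Definition _ := isLieSuper.Build K lquot
  lq_br_linearl lq_br_linearr lq_br_homog lq_br_anti lq_br_jacobi.

End Quotient.

Section Modules.
Context (K : fieldType) (h : finLieSuperType K).

Record hmodule := HModule {
  hm_car :> finSuperspaceType K;
  hm_act : h -> hm_car -> hm_car;
  hm_act_linearl : forall c x y v,
    hm_act (c *: x + y) v = c *: hm_act x v + hm_act y v;
  hm_act_linearr : forall c x v w,
    hm_act x (c *: v + w) = c *: hm_act x v + hm_act x w;
  hm_act_homog : forall p q x v,
    homog p x -> homog q v -> homog (p (+) q) (hm_act x v);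
  hm_act_lbr : forall p q x y v, homog p x -> homog q y ->
    hm_act (lbr x y) v =
      hm_act x (hm_act y v) - (-1) ^+ (p && q) *: hm_act y (hm_act x v)
}.

Definition is_submodule (M : hmodule) (U : {vspace M}) : Prop :=
  (forall v : M, v \in U -> even_part v \in U) /\
  (forall (x : h) (v : M), v \in U -> hm_act x v \in U).

Definition irreducible_module (M : hmodule) : Prop :=
  ({:M}%VS != 0%VS) /\
  (forall U : {vspace M}, is_submodule U -> U = 0%VS \/ U = {:M}%VS).

Definition module_iso (M N : hmodule) : Prop :=
  exists f : 'Hom(M, N), [/\ bijective f,
    forall v : M, f (even_part v) = even_part (f v) &
    forall (x : h) (v : M), f (hm_act x v) = hm_act x (f v)].

Definition odd_space : {vspace h} := lker (linfun (@even_part K h)).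

(* The rank of (x, y) |-> l [x, y] on the odd part, as that of its Gram matrix. *)
Definition rk (l : 'Hom(h, K^o)) : nat :=
  let b := vbasis odd_space in
  \rank (\matrix_(i < \dim odd_space, j < \dim odd_space)
           (l (lbr b`_i b`_j) : K)).

End Modules.

Section Duality.
Context (K : numClosedFieldType) (h : finLieSuperType K).

Definition omega (x : h) : h := - spart false x + 'i *: spart true x.
Definition omegaV (x : h) : h := - spart false x - 'i *: spart true x.

Lemma spart_spart (V : superspaceType K) p q (x : V) :
  spart p (spart q x) = if p == q then spart p x else 0.
Proof.
by case: p; case: q; rewrite /spart /= ?even_partB ?even_part_idem ?subrr ?subr0.
Qed.

Lemma omega_twist (s : bool) (x : h) :
  let tw b y := - spart false y + (-1) ^+ b *: ('i *: spart true y) in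
  tw (~~ s) (tw s x) = x.
Proof.
move=> tw; rewrite /tw; set a := spart false x; set b := spart true x.
have ii : 'i * 'i = -1 :> K by rewrite -expr2 sqrCi.
have E p : spart p (- a + (-1) ^+ s *: ('i *: b)) =
           - spart p a + (-1) ^+ s *: ('i *: spart p b).
  rewrite -scaleN1r spart_linear scaleN1r; congr (_ + _).
  by rewrite scalerA -[_ *: b]addr0 spart_linear -scalerA /spart even_part0
             subrr if_same addr0.
rewrite !E /a /b !spart_spart /= oppr0 !scaler0 addr0 add0r opprK !scalerA.
have -> : (-1) ^+ (~~ s) * 'i * (-1) ^+ s * 'i = 1 :> K.
  by case: s {E tw}; rewrite /= !(expr0, expr1) ?(mulN1r, mulrN1, mul1r, mulr1)
    mulNr ii opprK.
by rewrite scale1r -spartD.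
Qed.

Lemma omegaK : cancel omega omegaV.
Proof.
move=> x; have := omega_twist false x.
by rewrite /= !(expr0, expr1) scale1r scaleN1r.
Qed.

Lemma omegaVK : cancel omegaV omega.
Proof.
move=> x; have := omega_twist true x.
by rewrite /= !(expr0, expr1) scale1r scaleN1r.
Qed.

Lemma omegaV_linear c (x y : h) : omegaV (c *: x + y) = c *: omegaV x + omegaV y.
Proof.
rewrite /omegaV !spart_linear; move: (spart _ x) (spart _ y) (spart _ x) (spart _ y).
move=> a b a' b'; rewrite scalerBr scalerN scalerDr !opprD !scalerA.
by rewrite [c * _]mulrC addrACA.
Qed.

Lemma omegaV_homog p (x : h) : homog p x ->
  omegaV x = (if p then - 'i else -1) *: x.
Proof.
move=> <-; rewrite /omegaV !spart_spart; case: p => /=.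
  by rewrite oppr0 add0r scaleNr.
by rewrite scaler0 subr0 scaleN1r.
Qed.

(* omega is an automorphism because [h_0, h] = 0. *)
Section Dual.
Context (hq : forall t x : h, homog false t -> lbr t x = 0) (M : hmodule h).

Let dact (x : h) (v : M) : M := hm_act (omegaV x) v.

Let act0l (v : M) : hm_act 0 v = 0.
Proof.
have /eqP := hm_act_linearl 1 0 0 v; rewrite scale1r addr0 scale1r.
by rewrite -subr_eq0 opprD addNKr oppr_eq0 => /eqP.
Qed.

Let act0r (x : h) : hm_act x (0 : M) = 0.
Proof.
have /eqP := hm_act_linearr 1 x (0 : M) 0; rewrite scale1r addr0 scale1r.
by rewrite -subr_eq0 opprD addNKr oppr_eq0 => /eqP.
Qed.

Let actZl c x (v : M) : hm_act (c *: x) v = c *: hm_act x v.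
Proof. by rewrite -[_ *: x]addr0 hm_act_linearl act0l addr0. Qed.

Let actZr c x (v : M) : hm_act x (c *: v) = c *: hm_act x v.
Proof. by rewrite -[_ *: v]addr0 hm_act_linearr act0r addr0. Qed.

Lemma dual_linearl c x y (v : M) : dact (c *: x + y) v = c *: dact x v + dact y v.
Proof. by rewrite /dact omegaV_linear hm_act_linearl. Qed.

Lemma dual_linearr c x (v w : M) : dact x (c *: v + w) = c *: dact x v + dact x w.
Proof. exact: hm_act_linearr. Qed.

Lemma dual_homog p q x (v : M) :
  homog p x -> homog q v -> homog (p (+) q) (dact x v).
Proof.
move=> hx hv; rewrite /dact (omegaV_homog hx) actZl.
by apply/homogZ/hm_act_homog.
Qed.

Lemma dual_lbr p q x y (v : M) : homog p x -> homog q y ->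
  dact (lbr x y) v = dact x (dact y v) - (-1) ^+ (p && q) *: dact y (dact x v).
Proof.
move=> hx hy; have ii : 'i * 'i = -1 :> K by rewrite -expr2 sqrCi.
rewrite /dact (omegaV_homog (lbr_homog hx hy)) (omegaV_homog hx) (omegaV_homog hy).
rewrite !actZl !actZr.
have [pq|npq] := boolP (p && q).
  case/andP: pq hx hy => -> -> hx hy; rewrite (hm_act_lbr _ hx hy) /= expr1.
  by rewrite !scaleN1r !opprK !scalerA mulrNN ii -scalerDr scaleN1r.
have xy0 : lbr x y = 0.
  case: p hx npq => [|] hx npq; last exact: hq.
  case: q hy npq => // hy _.
  by rewrite (lbr_anti hx hy) (hq _ hy) scaler0 oppr0.
have := hm_act_lbr v hx hy; rewrite xy0 act0l (negPf npq) expr0 !scale1r scaler0.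
move/esym/eqP; rewrite subr_eq0 => /eqP ->.
by rewrite !scalerA [X in _ - X *: _]mulrC subrr.
Qed.

Definition dual_module : hmodule h :=
  HModule dual_linearl dual_linearr dual_homog dual_lbr.

End Dual.
End Duality.

(* The simple roots are indexed by cd_I.  An element of the dual of t = h_0 is
   encoded as a linear form on h that vanishes on h_1.  The module cd_g s i is
   g_alpha for alpha = alpha_i if s is false, and for -alpha_i if s is true. *)
Record cartan_datum (K : numClosedFieldType) := CartanDatum {
  cd_h : finLieSuperType K;
  cd_quasitoral : forall t x : cd_h, homog false t -> lbr t x = 0;
  cd_I : finType;
  cd_root : cd_I -> 'Hom(cd_h, K^o);
  cd_root_odd : forall i (x : cd_h), homog true x -> cd_root i x = 0;
  cd_root_free : free (codom cd_root);
  cd_g : bool -> cd_I -> hmodule cd_h;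
  cd_g_weight : forall s i (t : cd_h) (v : cd_g s i), homog false t ->
    hm_act t v = ((-1) ^+ s * (cd_root i t : K)) *: v;
  cd_pair : forall i, cd_g false i -> cd_g true i -> cd_h;
  cd_pair_linearl : forall i c (x x' : cd_g false i) (y : cd_g true i),
    cd_pair (c *: x + x') y = c *: cd_pair x y + cd_pair x' y;
  cd_pair_linearr : forall i c (x : cd_g false i) (y y' : cd_g true i),
    cd_pair x (c *: y + y') = c *: cd_pair x y + cd_pair x y';
  cd_pair_homog : forall i p q (x : cd_g false i) (y : cd_g true i),
    homog p x -> homog q y -> homog (p (+) q) (cd_pair x y);
  cd_pair_morph : forall i p q (a : cd_h) (x : cd_g false i) (y : cd_g true i),
    homog p a -> homog q x ->
    lbr a (cd_pair x y) =
      cd_pair (hm_act a x) y + (-1) ^+ (p && q) *: cd_pair x (hm_act a y);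
  cd_pair_nondegl : forall i (U : {vspace cd_g false i}),
    is_submodule U -> U != 0%VS ->
    exists x y, x \in U /\ cd_pair x y != 0;
  cd_pair_nondegr : forall i (U : {vspace cd_g true i}),
    is_submodule U -> U != 0%VS ->
    exists x y, y \in U /\ cd_pair x y != 0
}.

Section Contragredient.
Context (K : numClosedFieldType) (A : cartan_datum K).
Local Notation h := (cd_h A).
Local Notation g := (@cd_g K A).

Inductive gexpr : Type :=
| Gh of h
| Gg (s : bool) (i : cd_I A) of g s i
| G0
| Gadd of gexpr & gexpr
| Gscale of K & gexpr
| Geven of gexpr
| Gbr of gexpr & gexpr.

Definition Gpart (p : bool) (a : gexpr) : gexpr :=
  if p then Gadd a (Gscale (-1) (Geven a)) else Geven a.

(* The least congruence for which the expressions form a Lie superalgebra, the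
   generators span images of the superspaces h and g_alpha, and the defining
   relations hold. *)
Inductive geq : gexpr -> gexpr -> Prop :=
| geq_refl a : geq a a
| geq_sym a b : geq a b -> geq b a
| geq_trans a b c : geq a b -> geq b c -> geq a c
| geq_add a a' b b' : geq a a' -> geq b b' -> geq (Gadd a b) (Gadd a' b')
| geq_scale k a a' : geq a a' -> geq (Gscale k a) (Gscale k a')
| geq_even a a' : geq a a' -> geq (Geven a) (Geven a')
| geq_br a a' b b' : geq a a' -> geq b b' -> geq (Gbr a b) (Gbr a' b')
| geq_addA a b c : geq (Gadd a (Gadd b c)) (Gadd (Gadd a b) c)
| geq_addC a b : geq (Gadd a b) (Gadd b a)
| geq_add0 a : geq (Gadd G0 a) a
| geq_addN a : geq (Gadd (Gscale (-1) a) a) G0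
| geq_scaleA k l a : geq (Gscale k (Gscale l a)) (Gscale (k * l) a)
| geq_scale1 a : geq (Gscale 1 a) a
| geq_scaleDr k a b : geq (Gscale k (Gadd a b)) (Gadd (Gscale k a) (Gscale k b))
| geq_scaleDl k l a : geq (Gscale (k + l) a) (Gadd (Gscale k a) (Gscale l a))
| geq_even_linear k a b :
    geq (Geven (Gadd (Gscale k a) b)) (Gadd (Gscale k (Geven a)) (Geven b))
| geq_even_idem a : geq (Geven (Geven a)) (Geven a)
| geq_br_linearl k a b c :
    geq (Gbr (Gadd (Gscale k a) b) c) (Gadd (Gscale k (Gbr a c)) (Gbr b c))
| geq_br_linearr k a b c :
    geq (Gbr a (Gadd (Gscale k b) c)) (Gadd (Gscale k (Gbr a b)) (Gbr a c))
| geq_br_homog p q a b : geq (Gpart p a) a -> geq (Gpart q b) b ->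
    geq (Gpart (p (+) q) (Gbr a b)) (Gbr a b)
| geq_br_anti p q a b : geq (Gpart p a) a -> geq (Gpart q b) b ->
    geq (Gbr a b) (Gscale (-1) (Gscale ((-1) ^+ (p && q)) (Gbr b a)))
| geq_br_jacobi p q a b c : geq (Gpart p a) a -> geq (Gpart q b) b ->
    geq (Gbr a (Gbr b c))
        (Gadd (Gbr (Gbr a b) c) (Gscale ((-1) ^+ (p && q)) (Gbr b (Gbr a c))))
| geq_h_linear k x y : geq (Gh (k *: x + y)) (Gadd (Gscale k (Gh x)) (Gh y))
| geq_h_even x : geq (Geven (Gh x)) (Gh (even_part x))
| geq_g_linear s i k (v w : g s i) :
    geq (Gg (k *: v + w)) (Gadd (Gscale k (Gg v)) (Gg w))
| geq_g_even s i (v : g s i) : geq (Geven (Gg v)) (Gg (even_part v))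
| geq_rel_hh x y : geq (Gbr (Gh x) (Gh y)) (Gh (lbr x y))
| geq_rel_hg s i x (v : g s i) : geq (Gbr (Gh x) (Gg v)) (Gg (hm_act x v))
| geq_rel_pair i (x : g false i) (y : g true i) :
    geq (Gbr (Gg x) (Gg y)) (Gh (cd_pair x y))
| geq_rel_zero i j (x : g false i) (y : g true j) : i <> j ->
    geq (Gbr (Gg x) (Gg y)) G0.

HB.instance Definition _ := gen_eqMixin gexpr.
HB.instance Definition _ := gen_choiceMixin gexpr.

Definition geqb (a b : gexpr) : bool := `[< geq a b >].

Lemma geqb_refl : reflexive geqb.
Proof. by move=> a; apply/asboolP/geq_refl. Qed.
Lemma geqb_sym : symmetric geqb.
Proof. by move=> a b; apply/asboolP/asboolP; apply: geq_sym. Qed.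
Lemma geqb_trans : transitive geqb.
Proof. by move=> b a c /asboolP ab /asboolP bc; apply/asboolP/(geq_trans ab bc). Qed.

Canonical geqb_equiv := EquivRel geqb geqb_refl geqb_sym geqb_trans.

Definition tildeg : Type := {eq_quot geqb_equiv}%qT.
HB.instance Definition _ := Choice.on tildeg.

Definition tg_class (a : gexpr) : tildeg := \pi_({eq_quot geqb_equiv})%qT a.
Definition tg_rep (a : tildeg) : gexpr := repr (a : {eq_quot geqb_equiv}%qT).

Lemma tg_repK : cancel tg_rep tg_class. Proof. exact: reprK. Qed.

Lemma tg_classP a b : tg_class a = tg_class b <-> geq a b.
Proof. by split=> [/eqquotP/asboolP //|ab]; apply/eqquotP/asboolP. Qed.

Lemma tg_rep_class a : geq (tg_rep (tg_class a)) a.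
Proof. by apply/tg_classP; rewrite tg_repK. Qed.

Lemma tg_ind (P : tildeg -> Prop) : (forall a, P (tg_class a)) -> forall x, P x.
Proof. by move=> H x; rewrite -(tg_repK x). Qed.

Definition tg_add x y := tg_class (Gadd (tg_rep x) (tg_rep y)).
Definition tg_scale k x := tg_class (Gscale k (tg_rep x)).
Definition tg_opp x := tg_scale (-1) x.
Definition tg_even x := tg_class (Geven (tg_rep x)).
Definition tg_br x y := tg_class (Gbr (tg_rep x) (tg_rep y)).

Lemma tg_addE a b : tg_add (tg_class a) (tg_class b) = tg_class (Gadd a b).
Proof. by apply/tg_classP/geq_add; apply: tg_rep_class. Qed.
Lemma tg_scaleE k a : tg_scale k (tg_class a) = tg_class (Gscale k a).
Proof. by apply/tg_classP/geq_scale/tg_rep_class. Qed.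
Lemma tg_evenE a : tg_even (tg_class a) = tg_class (Geven a).
Proof. by apply/tg_classP/geq_even/tg_rep_class. Qed.
Lemma tg_brE a b : tg_br (tg_class a) (tg_class b) = tg_class (Gbr a b).
Proof. by apply/tg_classP/geq_br; apply: tg_rep_class. Qed.

Lemma tg_addA : associative tg_add.
Proof. by do 3!elim/tg_ind => ?; rewrite !tg_addE; apply/tg_classP/geq_addA. Qed.
Lemma tg_addC : commutative tg_add.
Proof. by do 2!elim/tg_ind => ?; rewrite !tg_addE; apply/tg_classP/geq_addC. Qed.
Lemma tg_add0 : left_id (tg_class G0) tg_add.
Proof. by elim/tg_ind => ?; rewrite !tg_addE; apply/tg_classP/geq_add0. Qed.
Lemma tg_addN : left_inverse (tg_class G0) tg_opp tg_add.
Proof.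
by elim/tg_ind => ?; rewrite /tg_opp tg_scaleE tg_addE; apply/tg_classP/geq_addN.
Qed.

HB.instance Definition _ :=
  GRing.isZmodule.Build tildeg tg_addA tg_addC tg_add0 tg_addN.

Lemma tg_scaleA k l v : tg_scale k (tg_scale l v) = tg_scale (k * l) v.
Proof. by elim/tg_ind: v => ?; rewrite !tg_scaleE; apply/tg_classP/geq_scaleA. Qed.
Lemma tg_scale1 : left_id 1 tg_scale.
Proof. by elim/tg_ind => ?; rewrite !tg_scaleE; apply/tg_classP/geq_scale1. Qed.
Lemma tg_scaleDr : right_distributive tg_scale +%R.
Proof.
move=> k; elim/tg_ind => a; elim/tg_ind => b.
rewrite [_ + _ in LHS]tg_addE !tg_scaleE [RHS]tg_addE.
exact/tg_classP/geq_scaleDr.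
Qed.
Lemma tg_scaleDl v : {morph tg_scale^~ v : a b / a + b}.
Proof.
move=> a b; elim/tg_ind: v => c; rewrite !tg_scaleE [RHS]tg_addE.
exact/tg_classP/geq_scaleDl.
Qed.

HB.instance Definition _ :=
  GRing.Zmodule_isLmodule.Build K tildeg tg_scaleA tg_scale1 tg_scaleDr tg_scaleDl.

Lemma tg_linE k a b :
  k *: tg_class a + tg_class b = tg_class (Gadd (Gscale k a) b).
Proof. by rewrite [_ *: _]tg_scaleE [LHS]tg_addE. Qed.

Lemma tg_even_linear (k : K) (x y : tildeg) :
  tg_even (k *: x + y) = k *: tg_even x + tg_even y.
Proof.
elim/tg_ind: x => a; elim/tg_ind: y => b.
rewrite tg_linE !tg_evenE tg_linE; exact/tg_classP/geq_even_linear.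
Qed.
Lemma tg_even_idem x : tg_even (tg_even x) = tg_even x.
Proof. by elim/tg_ind: x => a; rewrite !tg_evenE; apply/tg_classP/geq_even_idem. Qed.

HB.instance Definition _ := isSuperspace.Build K tildeg tg_even_linear tg_even_idem.

Lemma tg_homogE p a : homog p (tg_class a) <-> geq (Gpart p a) a.
Proof.
rewrite -tg_classP /homog /spart.
have E : even_part (tg_class a) = tg_class (Geven a) by exact: tg_evenE.
case: p => //=; rewrite E // addrC -scaleN1r tg_linE.
suff -> : tg_class (Gadd (Gscale (-1) (Geven a)) a) =
          tg_class (Gadd a (Gscale (-1) (Geven a))) by [].
exact/tg_classP/geq_addC.
Qed.

Lemma tg_br_linearl (k : K) (x y z : tildeg) :
  tg_br (k *: x + y) z = k *: tg_br x z + tg_br y z.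
Proof.
elim/tg_ind: x => a; elim/tg_ind: y => b; elim/tg_ind: z => c.
rewrite tg_linE !tg_brE tg_linE; exact/tg_classP/geq_br_linearl.
Qed.

Lemma tg_br_linearr (k : K) (x y z : tildeg) :
  tg_br x (k *: y + z) = k *: tg_br x y + tg_br x z.
Proof.
elim/tg_ind: x => a; elim/tg_ind: y => b; elim/tg_ind: z => c.
rewrite tg_linE !tg_brE tg_linE; exact/tg_classP/geq_br_linearr.
Qed.

Lemma tg_br_homog p q (x y : tildeg) :
  homog p x -> homog q y -> homog (p (+) q) (tg_br x y).
Proof.
elim/tg_ind: x => a; elim/tg_ind: y => b; rewrite tg_brE !tg_homogE.
exact: geq_br_homog.
Qed.

Lemma tg_br_anti p q (x y : tildeg) : homog p x -> homog q y ->
  tg_br x y = - ((-1) ^+ (p && q) *: tg_br y x).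
Proof.
elim/tg_ind: x => a; elim/tg_ind: y => b; rewrite !tg_brE !tg_homogE => ha hb.
rewrite -scaleN1r [_ ^+ _ *: _]tg_scaleE [RHS]tg_scaleE.
exact/tg_classP/geq_br_anti.
Qed.

Lemma tg_br_jacobi p q (x y z : tildeg) : homog p x -> homog q y ->
  tg_br x (tg_br y z) =
    tg_br (tg_br x y) z + (-1) ^+ (p && q) *: tg_br y (tg_br x z).
Proof.
elim/tg_ind: x => a; elim/tg_ind: y => b; elim/tg_ind: z => c.
rewrite !tg_brE !tg_homogE => ha hb.
rewrite [_ *: _]tg_scaleE [RHS]tg_addE.
exact/tg_classP/geq_br_jacobi.
Qed.

HB.instance Definition _ := isLieSuper.Build K tildeg
  tg_br_linearl tg_br_linearr tg_br_homog tg_br_anti tg_br_jacobi.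

Definition tg_h (x : h) : tildeg := tg_class (Gh x).
Definition tg_g s i (v : g s i) : tildeg := tg_class (Gg v).

Definition meets_h_trivially (J : ideal tildeg) : Prop :=
  forall x : h, J (tg_h x) -> tg_h x = 0.

(* The sum of all the ideals meeting h trivially, as the least ideal containing
   all of them; see max_idealP. *)
Definition max_ideal_mem (x : tildeg) : Prop :=
  forall J : ideal tildeg,
    (forall J' : ideal tildeg, meets_h_trivially J' -> forall y, J' y -> J y) ->
    J x.

Lemma max_ideal0 : max_ideal_mem 0.
Proof. by move=> J _; apply: ideal0. Qed.
Lemma max_ideal_linear c x y :
  max_ideal_mem x -> max_ideal_mem y -> max_ideal_mem (c *: x + y).
Proof. by move=> hx hy J hJ; apply: ideal_linear; [apply: hx|apply: hy]. Qed.
Lemma max_ideal_even x : max_ideal_mem x -> max_ideal_mem (even_part x).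
Proof. by move=> hx J hJ; apply/ideal_even_part/hx. Qed.
Lemma max_ideal_lbr x y : max_ideal_mem y -> max_ideal_mem (lbr x y).
Proof. by move=> hy J hJ; apply/ideal_lbr/hy. Qed.

Definition max_ideal : ideal tildeg :=
  Ideal max_ideal0 max_ideal_linear max_ideal_even max_ideal_lbr.

Lemma max_idealP (J : ideal tildeg) : meets_h_trivially J ->
  (forall J' : ideal tildeg, meets_h_trivially J' -> forall y, J' y -> J y) ->
  forall x, max_ideal x <-> J x.
Proof.
move=> hJ Jmax x; split; first by move/(_ J Jmax).
by move=> Jx J' hJ'; apply: hJ' hJ _ Jx.
Qed.

Definition gA : lieSuperType K := lquot max_ideal.

Definition in_h (x : h) : gA := lproj max_ideal (tg_h x).
Definition in_g s i (v : g s i) : gA := lproj max_ideal (tg_g v).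

Lemma in_h_act s i (x : h) (v : g s i) : lbr (in_h x) (in_g v) = in_g (hm_act x v).
Proof. by rewrite [LHS]lq_brE [lbr _ _]tg_brE; congr lproj; apply/tg_classP/geq_rel_hg. Qed.

Lemma in_g_pair i (x : g false i) (y : g true i) :
  lbr (in_g x) (in_g y) = in_h (cd_pair x y).
Proof. by rewrite [LHS]lq_brE [lbr _ _]tg_brE; congr lproj; apply/tg_classP/geq_rel_pair. Qed.

End Contragredient.

Section Notions.
Context (K : numClosedFieldType).

Definition bracket_span (L : lieSuperType K) (P Q : L -> Prop) (z : L) : Prop :=
  exists (n : nat) (x y : 'I_n -> L),
    (forall k, P (x k) /\ Q (y k)) /\ z = \sum_(k < n) lbr (x k) (y k).

Definition brackets_vanish (L : lieSuperType K) (P Q : L -> Prop) : Prop :=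
  forall x y, P x -> Q y -> lbr x y = 0.

Definition is_subalgebra (L : lieSuperType K) (S : L -> Prop) : Prop :=
  [/\ S 0,
      forall c x y, S x -> S y -> S (c *: x + y),
      forall x, S x -> S (even_part x) &
      forall x y, S x -> S y -> S (lbr x y)].

Definition even_heisenberg_triple (L : lieSuperType K) (e h f : L) : Prop :=
  [/\ [/\ homog false e, homog false h & homog false f],
      forall a b c : K, a *: e + b *: h + c *: f = 0 -> [/\ a = 0, b = 0 & c = 0],
      lbr e f = h, lbr h e = 0 & lbr h f = 0].

Context (A : cartan_datum K).
Local Notation g := (@cd_g K A).

(* h and the g_alpha are regarded as subspaces of gA, via in_h and in_g. *)
Definition root_space (s : bool) (i : cd_I A) (x : gA A) : Prop :=
  exists v : g s i, x = in_g v.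

Definition coroot (i : cd_I A) : gA A -> Prop :=
  bracket_span (root_space false i) (root_space true i).

Definition pure_coroot (i : cd_I A) (z : gA A) : Prop :=
  exists (p q : bool) (x y : gA A),
    [/\ root_space false i x, root_space true i y,
        homog p x /\ x <> 0, homog q y /\ y <> 0 & z = lbr x y].

Definition g_angle (i : cd_I A) (z : gA A) : Prop :=
  forall S : gA A -> Prop, is_subalgebra S ->
    (forall s x, root_space s i x -> S x) -> S z.

Definition integrable : Prop :=
  forall s i s' i', exists N : nat,
    forall (x : N.-tuple (g s i)) (y : g s' i'),
      foldr (fun u z => lbr (in_g u) z) (in_g y) x = 0.

Definition clifford_kac_moody : Prop :=
  (forall s i, irreducible_module (g s i)) /\ integrable.

Definition heisenberg_type (i : cd_I A) : Prop :=
  brackets_vanish (coroot i) (root_space false i).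

Definition type_he0 (i : cd_I A) : Prop :=
  [/\ heisenberg_type i, rk (cd_root i) = 0%N &
      forall s (v : g s i), homog false v].

Definition type_he0Pi (i : cd_I A) : Prop :=
  [/\ rk (cd_root i) = 0%N,
      \dim {:g false i}%VS = 1%N /\ \dim {:g true i}%VS = 1%N &
      exists p : bool, (forall v : g false i, homog p v) /\
                       (forall v : g true i, homog (~~ p) v)].

Definition type_he2Pi (i : cd_I A) : Prop :=
  [/\ heisenberg_type i, rk (cd_root i) = 2%N &
      ~ module_iso (g true i) (dual_module (@cd_quasitoral K A) (g false i))].

Definition type_H (n : nat) (i : cd_I A) : Prop :=
  heisenberg_type i /\ rk (cd_root i) = n.

End Notions.

(* Main.v *)
Require Import Defs.
From mathcomp Require Import all_boot all_order all_algebra.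
From mathcomp Require Import boolp reals complex.
From mathcomp Require Import zify ring.

(** Write [V], [W] for the root spaces of [alpha] and [- alpha].  Once every even
    pure coroot [h] is of the form [[e, f]] with [e], [f] even, the triple
    [e, h, f] is Heisenberg because [alpha h = 0]; and if [v] lies in another
    simple root space of root [beta], then [f v = 0] and
    [f e^(n+1) v = - (n+1) (beta h) e^n v], so nilpotency of [ad e] forces
    [(beta h) v = 0].  An odd coroot [c] then acts on an irreducible root space as
    a square-zero operator anticommuting with all odd elements, hence by zero.

    It remains to treat [h = [x, y]] with [x], [y] odd.  For odd [r] one has
    [[r x, r y] = [r, [x, r y]] - (alpha [r, r] / 2) h], so it is enough to find
    [r] with [alpha [r, r] <> 0] and [[x, r y] = 0].
    - If [rk alpha >= 3]: the odd part of the pairing is invariant, so by Schur's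
      lemma its values lie on a line.  The condition [[x, r y] = 0] thus holds on a
      hyperplane, and a form of rank at least 3 has no isotropic hyperplane.
    - If [rk alpha = 2]: for orthogonal odd [a], [b] the operator [a b] has a single
      eigenvalue on the even part of [V] and of [W].  If the two are opposite, [W] is
      isomorphic to the dual of [V]; if they agree, invariance under [a] and [b]
      makes the odd part of the pairing vanish.
    - In the rank 0 types such an [h] vanishes by parity. *)

Set Implicit Arguments.
Unset Strict Implicit.
Unset Printing Implicit Defensive.

Import GRing.Theory Num.Theory.

(** * Maps known only through a linearity identity *)

Section LinearFunctions.
Local Open Scope ring_scope.
Context (K : fieldType) (U V : lmodType K) (f : U -> V).
Hypothesis flin : forall c x y, f (c *: x + y) = c *: f x + f y.

Lemma lin_add x y : f (x + y) = f x + f y.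
Proof. by rewrite -[x in LHS]scale1r flin scale1r. Qed.

Lemma lin0 : f 0 = 0.
Proof. by apply: (addIr (f 0)); rewrite -lin_add !add0r. Qed.

Lemma linZ c x : f (c *: x) = c *: f x.
Proof. by rewrite -[c *: x]addr0 flin lin0 addr0. Qed.

Lemma linN x : f (- x) = - f x.
Proof. by rewrite -scaleN1r linZ scaleN1r. Qed.

Lemma lin_sum (I : Type) (r : seq I) (P : pred I) (F : I -> U) :
  f (\sum_(i <- r | P i) F i) = \sum_(i <- r | P i) f (F i).
Proof. exact: (big_morph f lin_add lin0). Qed.

End LinearFunctions.

(** * Homogeneous elements of superspaces *)

Section Parity.
Local Open Scope ring_scope.
Context (K : fieldType) (V : superspaceType K).
Implicit Types (x y : V) (p : bool).

Lemma homog_evenE x : homog false x <-> even_part x = x.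
Proof. by []. Qed.

Lemma homog_oddE x : homog true x <-> even_part x = 0.
Proof.
split=> [hx|hx]; last by rewrite /homog /spart hx subr0.
by rewrite -[x]hx /spart even_partB even_part_idem subrr.
Qed.

Lemma homog0 p : homog p (0 : V).
Proof. by case: p; [apply/homog_oddE|]; apply: even_part0. Qed.

Lemma homogD p x y : homog p x -> homog p y -> homog p (x + y).
Proof.
case: p => [/homog_oddE hx /homog_oddE hy|/homog_evenE hx /homog_evenE hy].
  by apply/homog_oddE; rewrite even_partD hx hy addr0.
by apply/homog_evenE; rewrite even_partD hx hy.
Qed.

Lemma homog_sum p (I : Type) (r : seq I) (P : pred I) (F : I -> V) :
  (forall i, homog p (F i)) -> homog p (\sum_(i <- r | P i) F i).
Proof. by move=> hF; apply: big_ind => // [|x y]; [apply: homog0|apply: homogD]. Qed.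

Lemma homog_both x : homog false x -> homog true x -> x = 0.
Proof. by move=> hx /homog_oddE hy; rewrite -[x]hx. Qed.

Lemma homog_neq p q x : p != q -> homog p x -> homog q x -> x = 0.
Proof. by case: p; case: q => // _ hx hy; apply: homog_both. Qed.

Lemma spart_other p q x : homog p x -> p != q -> spart q x = 0.
Proof.
move=> hx pq; apply: (homog_neq pq); last exact: spart_homog.
have := spart_homog p x; rewrite hx; move: p q pq hx => [] [] //= _ hx _.
  by rewrite /spart; move/homog_oddE: hx => ->; apply: homog0.
by rewrite /spart [even_part x]hx subrr; apply: homog0.
Qed.

Lemma homog_add0 x y : homog false x -> homog true y -> x + y = 0 -> x = 0 /\ y = 0.
Proof.
move=> /homog_evenE hx /homog_oddE hy xy.
have x0 : x = 0 by rewrite -[LHS]hx -[LHS]addr0 -hy -even_partD xy even_part0.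
by split=> //; rewrite x0 add0r in xy.
Qed.

Lemma spart_ind (P : V -> Prop) : (forall x y, P x -> P y -> P (x + y)) ->
  (forall p x, homog p x -> P x) -> forall x, P x.
Proof.
by move=> PD Ph x; rewrite (spartD x); apply: PD; apply: Ph; apply: spart_homog.
Qed.

End Parity.

(** * Brackets with even elements, and nilpotency *)

Section LieSuper.
Local Open Scope ring_scope.
Context (K : numFieldType) (L : lieSuperType K).
Implicit Types x y z : L.

Lemma lbr_even_anti x y : homog false x -> lbr x y = - lbr y x.
Proof.
move=> hx; elim/spart_ind: y => [y z hy hz|p y hy].
  by rewrite lbrDl lbrDr hy hz opprD.
by rewrite (lbr_anti hx hy) scale1r.
Qed.

Lemma lbr_odd_sym x y : homog true x -> homog true y -> lbr x y = lbr y x.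
Proof. by move=> hx hy; rewrite (lbr_anti hx hy) scaleN1r opprK. Qed.

Lemma lbr_suml (I : Type) (r : seq I) (P : pred I) (F : I -> L) y :
  lbr (\sum_(i <- r | P i) F i) y = \sum_(i <- r | P i) lbr (F i) y.
Proof. exact (lin_sum (fun c x x' => lbr_linearl c x x' y) r P F). Qed.

Lemma lbr_even_jacobi x y z : homog false x -> homog false y ->
  lbr x (lbr y z) = lbr (lbr x y) z + lbr y (lbr x z).
Proof. by move=> hx hy; rewrite (lbr_jacobi z hx hy) scale1r. Qed.

(* In the Heisenberg algebra, f e^(n+1) v = - (n+1) b e^n v. *)
Lemma heisenberg_nilpotent (e h f v : L) (b : K) (N : nat) :
  homog false e -> homog false h -> homog false f ->
  lbr e f = h -> lbr h e = 0 -> lbr f v = 0 -> lbr h v = b *: v ->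
  iter N (lbr e) v = 0 -> b *: v = 0.
Proof.
move=> he hh hf ef he0 fv hv.
have hw n : lbr h (iter n (lbr e) v) = b *: iter n (lbr e) v.
  by elim: n => //= n IH; rewrite lbr_even_jacobi // he0 lbr0l add0r IH lbrZr.
have fe : lbr f e = - h by rewrite lbr_even_anti // ef.
have fw n : lbr f (iter n.+1 (lbr e) v) = - (n.+1%:R * b) *: iter n (lbr e) v.
  elim: n => [|n IH]; rewrite iterS lbr_even_jacobi // fe -scaleN1r lbrZl hw.
    by rewrite /= fv lbr0r addr0 mul1r scaleN1r scaleNr.
  rewrite IH lbrZr -iterS scaleN1r -scaleNr -scalerDl -opprD; congr (- _ *: _).
  by rewrite -[in RHS]natr1 mulrDl mul1r addrC.
have [->|b0] := eqVneq b 0; first by rewrite scale0r.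
(* As [b] is nonzero, applying [f] to [e^(n+1) v = 0] gives [e^n v = 0]; descending, [v = 0]. *)
elim: N => [/= ->|n IH wn]; first by rewrite scaler0.
apply: IH; have /esym/eqP := fw n; rewrite wn lbr0r scaler_eq0 oppr_eq0 mulf_eq0.
by rewrite pnatr_eq0 (negPf b0) /= => /eqP.
Qed.

End LieSuper.

(** * Recognizing even Heisenberg triples *)

Section HeisenbergTriple.
Local Open Scope ring_scope.

(** Independence: bracketing a linear relation with [f] on the right leaves only [a *: h], and
    bracketing with [e] on the left only [c *: h], since [[x, x] = 0] for even [x]. *)
Lemma heisenberg_tripleP (K : numClosedFieldType) (L : lieSuperType K) (e h f : L) :
  homog false e -> homog false f -> lbr e f = h -> lbr h e = 0 -> lbr h f = 0 ->
  h <> 0 -> even_heisenberg_triple e h f.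
Proof.
move=> he hf ef he0 hf0 h0.
have hh : homog false h by rewrite -ef; apply: (lbr_homog he hf).
have eh0 : lbr e h = 0 by rewrite lbr_even_anti // he0 oppr0.
have ee0 (x : L) : homog false x -> lbr x x = 0.
  move=> hx; have /eqP := lbr_even_anti x hx.
  by rewrite -subr_eq0 opprK -mulr2n -scaler_nat scaler_eq0 pnatr_eq0 => /eqP.
split=> // a b c abc.
have a0 : a = 0.
  have : lbr (a *: e + b *: h + c *: f) f = 0 by rewrite abc lbr0l.
  rewrite !lbrDl !lbrZl ef hf0 ee0 // !scaler0 !addr0 => /eqP.
  by rewrite scaler_eq0 => /orP[/eqP //|/eqP].
have c0 : c = 0.
  have : lbr e (a *: e + b *: h + c *: f) = 0 by rewrite abc lbr0r.
  rewrite !lbrDr !lbrZr ef eh0 ee0 // !scaler0 !add0r => /eqP.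
  by rewrite scaler_eq0 => /orP[/eqP //|/eqP].
split=> //; move: abc; rewrite a0 c0 !scale0r add0r addr0 => /eqP.
by rewrite scaler_eq0 => /orP[/eqP //|/eqP].
Qed.

End HeisenbergTriple.

(** * Subspaces cut out by linear predicates *)

Section SubspaceOfPredicate.
Local Open Scope ring_scope.
Context (K : fieldType) (V : vectType K).

(** A subspace of maximal dimension inside [S] contains every vector of [S], since adjoining one
    stays inside [S]. *)
Lemma vspace_of_pred (S : V -> Prop) : S 0 ->
  (forall c x y, S x -> S y -> S (c *: x + y)) ->
  exists U : {vspace V}, forall v, v \in U <-> S v.
Proof.
move=> S0 Slin.
pose Q n := `[< exists2 U : {vspace V}, \dim U = n & forall v, v \in U -> S v >].
have exQ : exists n, Q n.
  by exists 0%N; apply/asboolP; exists 0%VS; rewrite ?dimv0 // => v /[!memv0] /eqP ->.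
have boundQ n : Q n -> (n <= \dim {:V})%N.
  by move=> /asboolP[U <- _]; apply/dimvS/subvf.
have [n /asboolP[U Un US] maxn] := ex_maxnP exQ boundQ.
exists U => v; split=> [/US //|Sv].
have : Q (\dim (<[v]> + U)%VS).
  apply/asboolP; exists (<[v]> + U)%VS => // w.
  move=> /memv_addP[_ /vlineP[c ->] [u /US Su ->]].
  exact: Slin.
move/maxn; rewrite -Un => dimU.
have /eqP -> : U == (<[v]> + U)%VS by rewrite eqEdim addvSr.
by apply: (subvP (addvSl _ _)); apply: memv_line.
Qed.

End SubspaceOfPredicate.

(** * Modules and irreducibility *)

Section ModuleTheory.
Local Open Scope ring_scope.
Context (K : numFieldType) (h : finLieSuperType K) (M : hmodule h).
Implicit Types (x : h) (v w : M).

Lemma actDl x y v : hm_act (x + y) v = hm_act x v + hm_act y v.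
Proof. exact (lin_add (fun c x y => hm_act_linearl c x y v) x y). Qed.

Lemma actZl c x v : hm_act (c *: x) v = c *: hm_act x v.
Proof. exact (linZ (fun c x y => hm_act_linearl c x y v) c x). Qed.

Lemma act0l v : hm_act 0 v = 0.
Proof. exact (lin0 (fun c x y => hm_act_linearl c x y v)). Qed.

Lemma actDr x v w : hm_act x (v + w) = hm_act x v + hm_act x w.
Proof. exact (lin_add (fun c => hm_act_linearr c x) v w). Qed.

Lemma actZr c x v : hm_act x (c *: v) = c *: hm_act x v.
Proof. exact (linZ (fun c => hm_act_linearr c x) c v). Qed.

Lemma act0r x : hm_act x (0 : M) = 0.
Proof. exact (lin0 (fun c => @hm_act_linearr _ _ M c x)). Qed.

Lemma act_odd_lbr x y v : homog true x -> homog true y ->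
  hm_act (lbr x y) v = hm_act x (hm_act y v) + hm_act y (hm_act x v).
Proof. by move=> hx hy; rewrite (hm_act_lbr v hx hy) scaleN1r opprK. Qed.

Lemma act_odd_sqr x v : homog true x ->
  hm_act x (hm_act x v) = 2%:R^-1 *: hm_act (lbr x x) v.
Proof.
move=> hx; rewrite act_odd_lbr // -mulr2n -scaler_nat scalerA mulVf ?scale1r //.
by rewrite pnatr_eq0.
Qed.

(** Lets irreducibility be applied to kernels, radicals and spans given as predicates. *)
Lemma irreducible_pred (S : M -> Prop) : irreducible_module M ->
  S 0 -> (forall c v w, S v -> S w -> S (c *: v + w)) ->
  (forall v, S v -> S (even_part v)) -> (forall x v, S v -> S (hm_act x v)) ->
  (exists2 v, v != 0 & S v) -> forall v, S v.
Proof.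
move=> [_ Mirr] S0 Slin Sev Sact [v0 v00 Sv0].
have [U US] := vspace_of_pred S0 Slin.
have subU : is_submodule U by split=> [v|x v] /US Sv; apply/US; auto.
case: (Mirr U subU) => E v; apply/US; last by rewrite E memvf.
by move/US: Sv0; rewrite E memv0 (negPf v00).
Qed.

(** The square of [c] acts as [[c, c] / 2], that is, by zero, and [c] commutes up to sign with the
    whole action, so its kernel is a graded submodule. The kernel contains [c v], so it is
    everything as soon as [c v] is nonzero. *)
Lemma odd_central_act0 c : irreducible_module M -> homog true c ->
  (forall t : h, homog false t -> lbr t c = 0) ->
  (forall a v, homog true a -> hm_act (lbr a c) v = 0) ->
  forall v, hm_act c v = 0.
Proof.
move=> Mirr hc tc ac v.
have ccv : hm_act c (hm_act c v) = 0 by rewrite act_odd_sqr // ac // scaler0.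
apply/eqP/negPn/negP => cv0; case/eqP: (cv0).
have ex : exists2 w : M, w != 0 & hm_act c w = 0 by exists (hm_act c v).
apply: (irreducible_pred (S := fun v => hm_act c v = 0) Mirr _ _ _ _ ex).
- exact: act0r.
- by move=> k u w hu hw; rewrite hm_act_linearr hu hw scaler0 addr0.
- move=> u cu.
  have cu0 := hm_act_homog hc (spart_homog false u).
  have cu1 := hm_act_homog hc (spart_homog true u).
  have : hm_act c (spart true u) + hm_act c (spart false u) = 0.
    by rewrite -actDr addrC -spartD.
  by case/(homog_add0 cu1 cu0).
move=> x u cu; elim/spart_ind: x => [x y hx hy|p x hx].
  by rewrite actDl actDr hx hy addr0.
have xc : hm_act (lbr x c) u = 0.
  by case: p hx => hx; [apply: ac|rewrite tc // act0l].
move: xc; rewrite (hm_act_lbr u hx hc) cu act0r add0r => /eqP.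
rewrite oppr_eq0 scaler_eq0 => /orP[|/eqP //].
by case: (p && true); rewrite ?expr1 ?expr0 ?oppr_eq0 oner_eq0.
Qed.

End ModuleTheory.

(** * Images of [h] and of the root spaces in [gA] *)

Section Generic.
Local Open Scope ring_scope.
Context (K : numClosedFieldType) (A : cartan_datum K).
Local Notation h := (cd_h A).
Local Notation g := (@cd_g K A).
Implicit Type i j : cd_I A.

Lemma in_g_linear s i c (v w : g s i) : in_g (c *: v + w) = c *: in_g v + in_g w.
Proof.
rewrite /in_g -lproj_linear; congr lproj.
by rewrite /tg_g tg_linE; apply/tg_classP/geq_g_linear.
Qed.

Lemma in_h_linear c (x y : h) : in_h (c *: x + y) = c *: in_h x + in_h y.
Proof.
rewrite /in_h -lproj_linear; congr lproj.
by rewrite /tg_h tg_linE; apply/tg_classP/geq_h_linear.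
Qed.

Lemma in_g_even s i (v : g s i) : even_part (in_g v) = in_g (even_part v).
Proof.
rewrite [LHS]lq_evenE [even_part _]tg_evenE; congr lproj.
exact/tg_classP/geq_g_even.
Qed.

Lemma in_h_even (x : h) : even_part (in_h x) = in_h (even_part x).
Proof.
rewrite [LHS]lq_evenE [even_part _]tg_evenE; congr lproj.
exact/tg_classP/geq_h_even.
Qed.

Lemma in_gD s i (v w : g s i) : in_g (v + w) = in_g v + in_g w.
Proof. exact (lin_add (@in_g_linear s i) v w). Qed.

Lemma in_gZ s i c (v : g s i) : in_g (c *: v) = c *: in_g v.
Proof. exact (linZ (@in_g_linear s i) c v). Qed.

Lemma in_g0 s i : in_g (0 : g s i) = 0.
Proof. exact (lin0 (@in_g_linear s i)). Qed.

Lemma in_hD (x y : h) : in_h (x + y) = in_h x + in_h y.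
Proof. exact (lin_add in_h_linear x y). Qed.

Lemma in_h0 : in_h (0 : h) = 0.
Proof. exact (lin0 in_h_linear). Qed.

Lemma in_g_spart s i p (v : g s i) : spart p (in_g v) = in_g (spart p v).
Proof.
case: p; rewrite /spart in_g_even // in_gD; congr (_ + _).
by rewrite -!scaleN1r in_gZ.
Qed.

Lemma in_g_homog s i p (v : g s i) : homog p v -> homog p (in_g v).
Proof. by rewrite /homog in_g_spart => ->. Qed.

Lemma root_space_homog s i p (x : gA A) : root_space s i x -> homog p x ->
  exists2 v : g s i, homog p v & x = in_g v.
Proof.
move=> [v ->] hv; exists (spart p v); first exact: spart_homog.
by rewrite -in_g_spart.
Qed.

Lemma lbr_in_g_neq i j (x : g false i) (y : g true j) : i <> j ->
  lbr (in_g x) (in_g y) = 0.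
Proof.
move=> ij; rewrite [LHS]lq_brE [lbr _ _]tg_brE.
have -> : 0 = lproj (max_ideal A) 0 :> gA A by [].
by congr lproj; apply/tg_classP/geq_rel_zero.
Qed.

Lemma pairDl i (x x' : g false i) (y : g true i) :
  cd_pair (x + x') y = cd_pair x y + cd_pair x' y.
Proof. exact (lin_add (fun c x x' => cd_pair_linearl c x x' y) x x'). Qed.

Lemma pairDr i (x : g false i) (y y' : g true i) :
  cd_pair x (y + y') = cd_pair x y + cd_pair x y'.
Proof. exact (lin_add (fun c => cd_pair_linearr c x) y y'). Qed.

Lemma pairZl i c (x : g false i) (y : g true i) :
  cd_pair (c *: x) y = c *: cd_pair x y.
Proof. exact (linZ (fun c x x' => cd_pair_linearl c x x' y) c x). Qed.

Lemma pairZr i c (x : g false i) (y : g true i) :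
  cd_pair x (c *: y) = c *: cd_pair x y.
Proof. exact (linZ (fun c => cd_pair_linearr c x) c y). Qed.

Lemma pair0l i (y : g true i) : cd_pair 0 y = 0 :> h.
Proof. exact (lin0 (fun c x x' => cd_pair_linearl c x x' y)). Qed.

Lemma pair0r i (x : g false i) : cd_pair x 0 = 0 :> h.
Proof. exact (lin0 (fun c => cd_pair_linearr c x)). Qed.

Lemma lbr_even_r (x t : h) : homog false t -> lbr x t = 0.
Proof.
move=> ht; apply/eqP; rewrite -oppr_eq0 -lbr_even_anti //.
by rewrite cd_quasitoral.
Qed.

(** The property to be checked type by type; the section [Conclusion] derives both claims from it
    and [heisenberg_type]. *)
Definition even_realizable i : Prop :=
  forall (x : g false i) (y : g true i), homog true x -> homog true y ->
  exists (x' : g false i) (y' : g true i),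
    [/\ homog false x', homog false y' & cd_pair x' y' = cd_pair x y].

(* [rx, ry] = [r, [x, ry]] - (alpha [r, r] / 2) [x, y] for odd r, x, y *)
Lemma even_realizable_shift i :
  (forall (x : g false i) (y : g true i), homog true x -> homog true y ->
     exists r : h, [/\ homog true r, cd_root i (lbr r r) != 0
                     & cd_pair x (hm_act r y) = 0]) ->
  even_realizable i.
Proof.
move=> ex_r x y hx hy; have [r [hr rr0 xry]] := ex_r x y hx hy.
have := cd_pair_morph (hm_act r y) hr hx; rewrite xry lbr0r act_odd_sqr //.
rewrite (cd_g_weight y (lbr_homog hr hr)) /= expr1 scalerA scaleN1r pairZr.
move/esym/eqP; rewrite subr_eq0; set c := _ * _ => /eqP E.
have c0 : c != 0.
  by rewrite mulf_neq0 ?invr_eq0 ?pnatr_eq0 // mulf_neq0 // oppr_eq0 oner_eq0.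
exists (c^-1 *: hm_act r x), (hm_act r y); split.
- exact/homogZ/(hm_act_homog hr hx).
- exact: (hm_act_homog hr hy).
by rewrite pairZl E scalerA mulVf // scale1r.
Qed.

(** * From even representatives to the two claims *)

Section Conclusion.
Context (i : cd_I A) (hCKM : clifford_kac_moody A).
Hypotheses (hH : heisenberg_type i) (hE : even_realizable i).

Lemma coroot_in_h (x : g false i) (y : g true i) : coroot i (in_h (cd_pair x y)).
Proof.
exists 1%N, (fun=> in_g x), (fun=> in_g y); split.
  by move=> _; split; [exists x|exists y].
by rewrite big_ord1 in_g_pair.
Qed.

(** Heisenberg type gives [[h, e] = 0], so [alpha h = 0] because [e] is nonzero; then [f], of weight
    [- alpha], is killed by [h] as well. *)
Lemma even_pure_triple (x : g false i) (y : g true i) :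
  homog false x -> homog false y -> in_h (cd_pair x y) <> 0 ->
  even_heisenberg_triple (in_g x) (in_h (cd_pair x y)) (in_g y).
Proof.
move=> hx hy t0; have ht := cd_pair_homog hx hy.
have te : lbr (in_h (cd_pair x y)) (in_g x) = 0.
  by apply: hH; [apply: coroot_in_h|exists x].
apply: heisenberg_tripleP => //; rewrite ?in_g_pair //; try exact: in_g_homog.
have : in_g x != 0 by apply/eqP => x0; apply: t0; rewrite -in_g_pair x0 lbr0l.
move: te; rewrite !in_h_act !(cd_g_weight _ ht) !in_gZ => /eqP.
rewrite scaler_eq0 mulf_eq0 /= oner_eq0 /= => /orP[/eqP -> _|-> //].
by rewrite mulr0 scale0r.
Qed.

Lemma even_pure_coroot_triple (x : g false i) (y : g true i) p :
  homog p x -> homog p y -> in_h (cd_pair x y) <> 0 ->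
  exists (x' : g false i) (y' : g true i), [/\ homog false x', homog false y',
    cd_pair x' y' = cd_pair x y &
    even_heisenberg_triple (in_g x') (in_h (cd_pair x y)) (in_g y')].
Proof.
move=> hx hy xy0.
have [x' [y' [hx' hy' E]]] : exists (x' : g false i) (y' : g true i),
    [/\ homog false x', homog false y' & cd_pair x' y' = cd_pair x y].
  by case: p hx hy => hx hy; [apply: hE|exists x, y].
exists x', y'; split=> //; rewrite -E; apply: even_pure_triple => //.
by rewrite E.
Qed.

Lemma root_space_g_angle s x : root_space s i x -> g_angle i x.
Proof. by move=> xs S _ hS; apply: hS xs. Qed.

Lemma even_pure_coroot_in_triple (z : gA A) :
  pure_coroot i z -> homog false z -> z <> 0 ->
  exists e f : gA A,
    [/\ even_heisenberg_triple e z f, g_angle i e, g_angle i z & g_angle i f].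
Proof.
move=> [p [q [x0 [y0 [xr yr [hx _] [hy _] zE]]]]] hz z0.
have [x hxx xE] := root_space_homog xr hx.
have [y hyy yE] := root_space_homog yr hy.
(* With opposite parities [[x, y]] would be odd as well as even, hence zero. *)
have pq : q = p.
  apply/eqP/negPn/negP => pq; apply: z0; apply: homog_both => //.
  have := lbr_homog hx hy; rewrite -zE.
  by move: p q pq {hx hy hxx hyy} => [] [].
rewrite {q}pq in hy hyy.
have zh : z = in_h (cd_pair x y) by rewrite zE xE yE in_g_pair.
have [|x' [y' [hx' hy' E T]]] := @even_pure_coroot_triple x y p hxx hyy.
  by rewrite -zh.
rewrite -zh in T; exists (in_g x'), (in_g y').
have ge : g_angle i (in_g x') by apply: root_space_g_angle; exists x'.
have gf : g_angle i (in_g y') by apply: root_space_g_angle; exists y'.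
split=> //; rewrite zh -E -in_g_pair => S hS Sr.
by have [_ _ _ Sb] := hS; apply: Sb; [apply: ge|apply: gf].
Qed.

Lemma even_pure_act0 (x : g false i) (y : g true i) p j (v : g false j) :
  homog p x -> homog p y -> lbr (in_h (cd_pair x y)) (in_g v) = 0.
Proof.
move=> hx hy; have [->|/eqP xy0] := eqVneq (in_h (cd_pair x y)) 0.
  by rewrite lbr0l.
have [ij|ij] := eqVneq j i.
  by subst j; apply: hH; [apply: coroot_in_h|exists v].
have [x' [y' [hx' hy' E [[he ht hf] _ ef te tf]]]] :=
  even_pure_coroot_triple hx hy xy0.
have ht' : homog false (cd_pair x y) by rewrite -E; apply: (cd_pair_homog hx' hy').
have [N hN] := hCKM.2 false i false j.
have tv : lbr (in_h (cd_pair x y)) (in_g v)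
    = (cd_root j (cd_pair x y) : K) *: in_g v.
  by rewrite in_h_act (cd_g_weight v ht') /= expr0 mul1r in_gZ.
(* [f] kills [v] by the defining relation for distinct simple roots, and integrability makes a power
   of [ad e] kill it. *)
rewrite tv; apply: (heisenberg_nilpotent (N := N) he ht hf ef te _ tv).
  by rewrite lbr_even_anti // lbr_in_g_neq ?oppr0 //; apply/eqP.
have := hN (nseq_tuple N x') v; rewrite /= => <-.
by elim: {hN}N => //= n ->.
Qed.

(** For odd [a], [[a, c]] is a combination of [[a x, y]] and [[x, a y]], whose entries have equal
    parity, so it acts by zero; then [odd_central_act0] applies to [c]. *)
Lemma odd_pure_act0 (x : g false i) (y : g true i) p q j (v : g false j) :
  p != q -> homog p x -> homog q y -> lbr (in_h (cd_pair x y)) (in_g v) = 0.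
Proof.
move=> pq hx hy; set c := cd_pair x y.
have hc : homog true c by have := cd_pair_homog hx hy; move: p q pq {hx hy} => [] [].
have qE : q = ~~ p by move: p q pq {hx hy hc} => [] [].
have ac0 (a : h) (w : g false j) : homog true a -> in_g (hm_act (lbr a c) w) = 0.
  move=> ha; rewrite -in_h_act /c (cd_pair_morph y ha hx) addrC.
  rewrite in_h_linear lbrDl lbrZl.
  rewrite (even_pure_act0 _ hx (_ : homog p (hm_act a y))); last first.
    by have := hm_act_homog ha hy; rewrite qE; case: (p).
  rewrite scaler0 add0r.
  rewrite (even_pure_act0 _ (_ : homog q (hm_act a x)) hy) //.
  by have := hm_act_homog ha hx; rewrite qE; case: (p).
rewrite in_h_act.
(* [ac0] is an equality in [gA], where [in_g] might kill vectors. One [w] with nonzero image forces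
   the weight of every [[a, c]] to vanish, hence its action on the module itself; without such a [w]
   the goal is immediate. *)
have [[w w0]|all0] := pselect (exists w : g false j, in_g w <> 0); last first.
  by apply: contrapT => cv0; apply: all0; exists (hm_act c v).
rewrite (@odd_central_act0 _ _ (g false j) c) ?in_g0 //.
- exact: hCKM.1.
- by move=> t ht; apply: cd_quasitoral.
move=> a u ha; have hac := lbr_homog ha hc.
move/eqP: (ac0 a w ha); rewrite !(cd_g_weight _ hac) in_gZ scaler_eq0.
by case/orP=> [/eqP ->|/eqP //]; rewrite scale0r.
Qed.

Lemma coroot_act0 j : brackets_vanish (coroot i) (root_space false j).
Proof.
move=> _ _ [n [x [y [xy ->]]]] [v ->].
rewrite lbr_suml; apply: big1 => k _; case: (xy k) => -[v' ->] [w' ->]; rewrite in_g_pair.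
elim/spart_ind: v' => [v1 v2 h1 h2|p v' hv].
  by rewrite pairDl in_hD lbrDl h1 h2 addr0.
elim/spart_ind: w' => [w1 w2 h1 h2|q w' hw].
  by rewrite pairDr in_hD lbrDl h1 h2 addr0.
have [pq|pq] := eqVneq p q; last exact: (odd_pure_act0 _ pq hv hw).
by rewrite pq in hv; apply: (even_pure_act0 _ hv hw).
Qed.

End Conclusion.

(** * The two types of rank 0 *)

Lemma he0_even_realizable i : type_he0 i -> even_realizable i.
Proof.
move=> [_ _ ev] x y hx _.
by exists 0, 0; split; [exact: homog0..|rewrite (homog_both (ev _ x) hx) !pair0l].
Qed.

Lemma he0Pi_even_realizable i : type_he0Pi i -> even_realizable i.
Proof.
move=> [_ _ [p [hV hW]]] x y hx hy.
exists 0, 0; split; try exact: homog0; rewrite pair0l.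
case: p hV hW => hV hW.
  by rewrite (homog_both (hW y) hy) pair0r.
by rewrite (homog_both (hV x) hx) pair0l.
Qed.

(** As [V] and [W] have opposite parities, coroots are odd and would move [V] to a parity in which
    it is zero. *)
Lemma he0Pi_heisenberg i : type_he0Pi i -> heisenberg_type i.
Proof.
move=> [_ _ [p [hV hW]]] _ _ [n [x [y [xy ->]]]] [v ->].
rewrite lbr_suml; apply: big1 => k _; case: (xy k) => -[v' ->] [w' ->]; rewrite in_g_pair in_h_act.
have := hm_act_homog (cd_pair_homog (hV v') (hW w')) (hV v).
have := hV (hm_act (cd_pair v' w') v).
case: p {hV hW} => h1 h2; rewrite (_ : hm_act _ _ = 0) ?in_g0 //.
  exact: (homog_both h2 h1).
exact: (homog_both h1 h2).
Qed.

End Generic.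

(** * Coordinates of vectors in a subspace *)

Section Coordinates.
Local Open Scope ring_scope.
Context (K : fieldType) (V : vectType K).

Definition bvec (U : {vspace V}) (u : 'rV[K]_(\dim U)) : V :=
  \sum_i u 0 i *: (vbasis U)`_i.

Lemma bvecP (U : {vspace V}) v : v \in U -> exists u, v = bvec (U := U) u.
Proof.
move=> vU; exists (\row_i coord (vbasis U) i v).
by rewrite {1}(coord_vbasis vU); apply: eq_bigr => i _; rewrite mxE.
Qed.

Lemma bvec_eq0 (U : {vspace V}) u : bvec (U := U) u = 0 -> u = 0.
Proof.
move=> u0; have /freeP fr := basis_free (vbasisP U).
by apply/rowP => i; rewrite mxE (fr (u 0)).
Qed.

End Coordinates.

(** * Gram matrices of bilinear maps *)

Section BilinearGram.
Local Open Scope ring_scope.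
Context (K : fieldType) (V W : vectType K) (U : {vspace V}) (U' : {vspace W}).
Context (f : V -> W -> K).
Hypothesis flinl : forall c x y z, f (c *: x + y) z = c * f x z + f y z.
Hypothesis flinr : forall c x y z, f x (c *: y + z) = c * f x y + f x z.

Definition bgram : 'M[K]_(\dim U, \dim U') :=
  \matrix_(i, j) f (vbasis U)`_i (vbasis U')`_j.

Lemma bgramE u w : f (bvec u) (bvec w) = (u *m bgram *m w^T) 0 0.
Proof.
rewrite /bvec (lin_sum (V := K^o) (fun c x y => flinl c x y _)).
have E i : f (u 0 i *: (vbasis U)`_i) (bvec w) = u 0 i * (bgram *m w^T) i 0.
  rewrite (linZ (V := K^o) (fun c x y => flinl c x y _)); congr (_ * _).
  rewrite /bvec (lin_sum (V := K^o) (fun c => flinr c _)) mxE; apply: eq_bigr => j _.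
  by rewrite (linZ (V := K^o) (fun c => flinr c _)) !mxE mulrC.
by rewrite -mulmxA mxE; apply: eq_bigr => i _; apply: E.
Qed.

End BilinearGram.

(** * Symmetric matrices and isotropic subspaces *)

Section SymmetricMatrices.
Local Open Scope ring_scope.
Context (K : numFieldType) (n : nat) (G : 'M[K]_n).
Hypothesis Gsym : G^T = G.
Implicit Types u v : 'rV[K]_n.

Lemma symform_sym u v : v *m G *m u^T = (u *m G *m v^T)^T.
Proof. by rewrite !trmx_mul trmxK Gsym mulmxA. Qed.

(** The width [m] is 1 for hyperplanes and 0 for the whole space. *)
Lemma symform_polar m (t : 'M[K]_(n, m)) :
  (forall u, u *m t = 0 -> u *m G *m u^T = 0) ->
  forall u v, u *m t = 0 -> v *m t = 0 -> u *m G *m v^T = 0.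
Proof.
move=> iso u v ut vt.
have := iso (u + v); rewrite mulmxDl ut vt addr0 => /(_ erefl).
rewrite linearD /= !mulmxDl !mulmxDr !iso // add0r addr0 (symform_sym u v).
move/matrixP/(_ 0 0) => /eqP; rewrite !mxE => /eqP E.
apply/matrixP => a b; rewrite !ord1 [RHS]mxE; apply/eqP; move/eqP: E.
by rewrite mxE -mulr2n mulrn_eq0.
Qed.

Lemma symform_nonzero : G != 0 -> exists u, u *m G *m u^T != 0.
Proof.
move=> G0; apply: contrapT => no; case/eqP: G0.
have iso u : u *m G *m u^T = 0.
  by apply/eqP/negPn/negP => u0; apply: no; exists u.
apply/matrixP => i j; have := @symform_polar n 0 (fun u _ => iso u)
  (delta_mx 0 i) (delta_mx 0 j) (mulmx0 _ _) (mulmx0 _ _).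
by rewrite -rowE trmx_delta -colE => /matrixP/(_ 0 0); rewrite !mxE.
Qed.

Lemma rank_kermx_cV (t : 'cV[K]_n) : (n <= (\rank (kermx t)).+1)%N.
Proof. by rewrite mxrank_ker -addn1 -leq_subLR subKn ?rank_leq_row // rank_leq_col. Qed.

(** Let [N] span the kernel of [t], so [rank N >= n - 1]. From [N G N^T = 0],
    [rank (N G) <= n - rank N], while [rank G <= rank (N G) + n - rank N]; hence
    [rank G <= 2 (n - rank N) <= 2]. *)
Lemma rank_isotropic_hyperplane (t : 'cV[K]_n) :
  (forall u, u *m t = 0 -> u *m G *m u^T = 0) -> (\rank G <= 2)%N.
Proof.
move=> iso; have := rank_kermx_cV t.
have : forall i, row i (kermx t) *m t = 0 by move=> i; apply/sub_kermxP/row_sub.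
move: (kermx t) => N rowN rkN.
have NGN : N *m G *m N^T = 0.
  apply/matrixP => i j; have /matrixP/(_ 0 0) E := symform_polar iso (rowN i) (rowN j).
  rewrite -row_mul mxE [RHS]mxE in E; rewrite mxE [RHS]mxE -[RHS]E.
  by apply: eq_bigr => k _; congr (_ * _); [rewrite [RHS]mxE|rewrite !mxE].
have := mulmx0_rank_max NGN; have := mxrank_mul_min N G.
rewrite mxrank_tr; lia.
Qed.

Lemma rank2_orthogonal : \rank G = 2%N -> exists a b : 'rV[K]_n,
  [/\ (a *m G *m a^T) 0 0 != 0, (b *m G *m b^T) 0 0 != 0, a *m G *m b^T = 0 &
      forall u, u *m G *m a^T = 0 -> u *m G *m b^T = 0 -> u *m G = 0].
Proof.
move=> rkG.
have nz (x : 'M[K]_1) : x != 0 -> x 0 0 != 0.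
  by apply: contra => /eqP x0; apply/eqP/matrixP => i j; rewrite !ord1 x0 mxE.
have [|a /nz aa] := symform_nonzero; first by rewrite -mxrank_eq0 rkG.
set A := (a *m G *m a^T) 0 0 in aa.
have aAE : a *m G *m a^T = A%:M by apply/matrixP => i j; rewrite !ord1 [RHS]mxE.
pose t := G *m a^T.
have [b bt /nz bb] : exists2 b : 'rV[K]_n, b *m t = 0 & b *m G *m b^T != 0.
  (* Otherwise the orthogonal of [a] is totally isotropic; being orthogonal to [a] too, it lies in
     the radical, and [G] has rank at most 1. *)
  apply: contrapT => no.
  have iso u : u *m t = 0 -> u *m G *m u^T = 0.
    by move=> ut; apply/eqP/negPn/negP => u0; apply: no; exists u.
  have kerG (u : 'rV_n) : u *m t = 0 -> u *m G = 0.
    move=> ut; apply: trmx_inj; rewrite trmx0; apply/row_matrixP => i.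
    (* [c] makes [v - c *: a] orthogonal to [a]. *)
    pose v : 'rV[K]_n := delta_mx 0 i; pose c := (v *m t) 0 0 / A.
    have vt : (v - c *: a) *m t = 0.
      rewrite mulmxBl -scalemxAl.
      have -> : a *m t = A%:M by rewrite mulmxA.
      by rewrite [v *m t]mx11_scalar scale_scalar_mx mulfVK // subrr.
    have := symform_polar iso ut vt; rewrite linearB /= linearZ /= mulmxBr -scalemxAr.
    rewrite -[u *m G *m a^T]mulmxA ut scaler0 subr0.
    by rewrite row0 rowE -/v => /(congr1 trmx); rewrite trmx_mul trmxK trmx0.
  have NG : kermx t *m G = 0.
    by apply/row_matrixP => i; rewrite row_mul row0 kerG //; apply/sub_kermxP/row_sub.
  have := mulmx0_rank_max NG; have := rank_kermx_cV t; rewrite rkG; lia.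
have ab : a *m G *m b^T = 0 by rewrite (symform_sym b a) -mulmxA bt trmx0.
exists a, b; split=> // u ua ub.
pose M := col_mx a b.
have MGM : M *m G *m M^T = block_mx (a *m G *m a^T) 0 0 (b *m G *m b^T).
  rewrite tr_col_mx mul_col_mx mul_col_row ab; congr block_mx.
  by rewrite -mulmxA bt.
have rkMG : \rank (M *m G) = 2%N.
  apply/eqP; rewrite eqn_leq rank_leq_row /=.
  apply: leq_trans (mxrankM_maxl (M *m G) M^T).
  rewrite MGM mxrank_unit // unitmxE det_ublock !det_mx11 unitfE mulf_neq0 //.
(* [M G] and [G] both have rank 2, so the rows of [G] are combinations of [a G] and [b G]. *)
have /submxP[X GE] : (G <= M *m G)%MS.
  by rewrite -(mxrank_leqif_sup (submxMl M G)) rkMG rkG.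
apply: trmx_inj; rewrite trmx_mul Gsym trmx0 GE -!mulmxA.
have -> : M *m (G *m u^T) = 0.
  rewrite mulmxA mul_col_mx mul_col_mx (symform_sym u a) (symform_sym u b) ua ub.
  by rewrite !trmx0 col_mx0.
by rewrite mulmx0.
Qed.

End SymmetricMatrices.

(** * The form of [rk] on odd elements *)

Section OddGram.
Local Open Scope ring_scope.
Context (K : numFieldType) (h : finLieSuperType K) (l : 'Hom(h, K^o)).
Local Notation n := (\dim (odd_space h)).

Lemma odd_spaceP (x : h) : x \in odd_space h <-> homog true x.
Proof.
rewrite memv_ker lfunE /=; split=> [/eqP ex|/homog_oddE ->]; last exact: eqxx.
exact/homog_oddE.
Qed.

Definition odd_vec (u : 'rV[K]_n) : h := bvec (U := odd_space h) u.

Lemma odd_vec_homog u : homog true (odd_vec u).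
Proof.
apply: homog_sum => j; apply: homogZ; apply/odd_spaceP.
by apply: vbasis_mem; apply: mem_nth; rewrite size_tuple.
Qed.

Lemma odd_vecP x : homog true x -> exists u, x = odd_vec u.
Proof. by move/odd_spaceP/bvecP. Qed.

Definition odd_gram : 'M[K]_n :=
  bgram (odd_space h) (odd_space h) (fun x y => l (lbr x y) : K).

Lemma odd_gramE u w : l (lbr (odd_vec u) (odd_vec w)) = (u *m odd_gram *m w^T) 0 0.
Proof.
apply: bgramE => c x y z; first by rewrite lbr_linearl linearP.
by rewrite lbr_linearr linearP.
Qed.

Lemma rk_odd_gram : rk l = \rank odd_gram.
Proof. by []. Qed.

Lemma odd_gram_sym : odd_gram^T = odd_gram.
Proof.
apply/matrixP => j k; rewrite !mxE lbr_odd_sym //; apply/odd_spaceP;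
  by apply: vbasis_mem; apply: mem_nth; rewrite size_tuple.
Qed.

End OddGram.

(** * The odd part of the pairing, and rank at least 3 *)

Section OddCoroots.
Local Open Scope ring_scope.
Context (K : numClosedFieldType) (A : cartan_datum K) (i : cd_I A).
Local Notation h := (cd_h A).
Local Notation V := (@cd_g K A false i).
Local Notation W := (@cd_g K A true i).
Hypotheses (Virr : irreducible_module V) (Wirr : irreducible_module W).

(** For odd [x], [y], [r] it agrees with [[x, r y]], and it is invariant up to sign, whereas
    [cd_pair] is only equivariant. *)
Definition odd_pair (x : V) (y : W) : h := spart true (cd_pair x y).

Lemma odd_pair_linearl c x x' y :
  odd_pair (c *: x + x') y = c *: odd_pair x y + odd_pair x' y.
Proof. by rewrite /odd_pair cd_pair_linearl spart_linear. Qed.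

Lemma odd_pair_linearr c x y y' :
  odd_pair x (c *: y + y') = c *: odd_pair x y + odd_pair x y'.
Proof. by rewrite /odd_pair cd_pair_linearr spart_linear. Qed.

Lemma odd_pair_neq p x y : homog p x -> homog (~~ p) y -> odd_pair x y = cd_pair x y.
Proof. by move=> hx hy; have := cd_pair_homog hx hy; case: p {hx hy}. Qed.

Lemma odd_pair_same p x y : homog p x -> homog p y -> odd_pair x y = 0.
Proof.
move=> hx hy; have := cd_pair_homog hx hy; rewrite addbb => hxy.
exact: (spart_other hxy).
Qed.

(** Only components of opposite parities contribute to the odd part. *)
Lemma odd_pair_spart p x y : odd_pair (spart p x) y = odd_pair x (spart (~~ p) y).
Proof.
have h1 := odd_pair_same (spart_homog p x) (spart_homog p y).
have h2 := odd_pair_same (spart_homog (~~ p) x) (spart_homog (~~ p) y).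
have E (z : W) : z = spart p z + spart (~~ p) z.
  by case: (p) => /=; rewrite [LHS]spartD // addrC.
have E' (z : V) : z = spart p z + spart (~~ p) z.
  by case: (p) => /=; rewrite [LHS]spartD // addrC.
rewrite {1}(E y) (lin_add (fun c => odd_pair_linearr c _)) h1 add0r.
by rewrite {2}(E' x) (lin_add (fun c x x' => odd_pair_linearl c x x' _)) h2 addr0.
Qed.

(** Bracketing with [a] kills the even part of [h] and makes the odd part even, so [[a, [x, y]]] has
    no odd part. *)
Lemma odd_pair_invariant (a : h) p x y : homog true a -> homog p x ->
  odd_pair (hm_act a x) y = - ((-1) ^+ p *: odd_pair x (hm_act a y)).
Proof.
move=> ha hx; apply/eqP; rewrite -subr_eq0 opprK /odd_pair addrC -spart_linear addrC.
have -> : (-1) ^+ p *: cd_pair x (hm_act a y) =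
    (-1) ^+ (true && p) *: cd_pair x (hm_act a y) by [].
rewrite -(cd_pair_morph y ha hx); apply/eqP; move: (cd_pair x y) => z.
rewrite (spartD z) lbrDr lbr_even_r ?add0r; last exact: spart_homog.
exact: (spart_other (lbr_homog ha (spart_homog true z))).
Qed.

(** * Radicals of scalar forms made from the odd pairing *)

Section Functional.
Context (phi : h -> K).
Hypothesis phi_lin : forall c x y, phi (c *: x + y) = c * phi x + phi y.

Let phi0 : phi 0 = 0.
Proof. exact (lin0 (V := K^o) phi_lin). Qed.
Let phiZ c x : phi (c *: x) = c * phi x.
Proof. exact (linZ (V := K^o) phi_lin c x). Qed.
Let phiN x : phi (- x) = - phi x.
Proof. exact (linN (V := K^o) phi_lin x). Qed.
Let phiD x y : phi (x + y) = phi x + phi y.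
Proof. exact (lin_add (V := K^o) phi_lin x y). Qed.

(** By invariance the left radical is a graded submodule of the irreducible [V]. *)
Lemma odd_pair_degenerate_left :
  (exists2 v, v != 0 & forall w, phi (odd_pair v w) = 0) ->
  forall v w, phi (odd_pair v w) = 0.
Proof.
apply: (irreducible_pred (S := fun v => forall w, phi (odd_pair v w) = 0) Virr).
- by move=> w; rewrite (lin0 (fun c x x' => odd_pair_linearl c x x' _)) phi0.
- by move=> c x y hx hy w; rewrite odd_pair_linearl phi_lin hx hy mulr0 addr0.
- by move=> x hx w; rewrite (odd_pair_spart false).
move=> a x hx w; elim/spart_ind: a => [a b ha hb|[] a ha].
- by rewrite actDl (lin_add (fun c x x' => odd_pair_linearl c x x' _)) phiD ha hb addr0.
- have hp p : phi (odd_pair (hm_act a (spart p x)) w) = 0.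
    rewrite (odd_pair_invariant _ ha (spart_homog p x)) odd_pair_spart phiN phiZ hx.
    by rewrite mulr0 oppr0.
  rewrite (spartD x) actDr (lin_add (fun c x x' => odd_pair_linearl c x x' _)) phiD.
  by rewrite !hp addr0.
rewrite (cd_g_weight _ ha) (linZ (fun c x x' => odd_pair_linearl c x x' _)) phiZ hx.
by rewrite mulr0.
Qed.

Lemma odd_pair_degenerate_right :
  (exists2 w, w != 0 & forall v, phi (odd_pair v w) = 0) ->
  forall w v, phi (odd_pair v w) = 0.
Proof.
apply: (irreducible_pred (S := fun w => forall v, phi (odd_pair v w) = 0) Wirr).
- by move=> v; rewrite (lin0 (fun c => odd_pair_linearr c _)) phi0.
- by move=> c x y hx hy w; rewrite odd_pair_linearr phi_lin hx hy mulr0 addr0.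
- by move=> w hw v; rewrite -(odd_pair_spart true).
move=> a w hw v; elim/spart_ind: a => [a b ha hb|[] a ha].
- by rewrite actDl (lin_add (fun c => odd_pair_linearr c _)) phiD ha hb addr0.
- elim/spart_ind: v => [v v' hv hv'|p v hv].
    by rewrite (lin_add (fun c x x' => odd_pair_linearl c x x' _)) phiD hv hv' addr0.
  have /(congr1 phi)/eqP := odd_pair_invariant w ha hv; rewrite hw phiN phiZ.
  by rewrite eq_sym oppr_eq0 mulf_eq0 signr_eq0 /= => /eqP.
rewrite (cd_g_weight _ ha) (linZ (fun c => odd_pair_linearr c _)) phiZ hw.
by rewrite mulr0.
Qed.

End Functional.

(* Schur's lemma for invariant forms: an eigenvalue of [phi] relative to [psi]
   makes their difference degenerate, hence zero. *)
Lemma odd_pair_schur (phi psi : h -> K) :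
  (forall c x y, phi (c *: x + y) = c * phi x + phi y) ->
  (forall c x y, psi (c *: x + y) = c * psi x + psi y) ->
  (exists v w, psi (odd_pair v w) != 0) ->
  exists k, forall v w, phi (odd_pair v w) = k * psi (odd_pair v w).
Proof.
move=> phil psil [v0 [w0 psi0]].
pose f (chi : h -> K) v w := chi (odd_pair v w).
have fl chi : (forall c x y, chi (c *: x + y) = c * chi x + chi y) ->
    forall c x y z, f chi (c *: x + y) z = c * f chi x z + f chi y z.
  by move=> chil c x y z; rewrite /f odd_pair_linearl chil.
have fr chi : (forall c x y, chi (c *: x + y) = c * chi x + chi y) ->
    forall c x y z, f chi x (c *: y + z) = c * f chi x y + f chi x z.
  by move=> chil c x y z; rewrite /f odd_pair_linearr chil.
pose M1 := bgram {:V}%VS {:W}%VS (f phi); pose M2 := bgram {:V}%VS {:W}%VS (f psi).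
have E1 u w : f phi (bvec u) (bvec w) = (u *m M1 *m w^T) 0 0.
  exact: (bgramE (fl _ phil) (fr _ phil)).
have E2 u w : f psi (bvec u) (bvec w) = (u *m M2 *m w^T) 0 0.
  exact: (bgramE (fl _ psil) (fr _ psil)).
(* A nonzero column of the cokernel would give a vector of [W] in the right radical for [psi]. Full
   rank makes [pinvmx M2] a left inverse of [M2]. *)
have full2 : row_full M2.
  rewrite -cokermx_eq0; apply/negPn/negP => coker0.
  have /matrix0Pn[l [j clj]] := coker0.
  have cj : col j (cokermx M2) != 0 by apply/matrix0Pn; exists l, 0; rewrite mxE.
  case/eqP: psi0; apply: odd_pair_degenerate_right => //.
  exists (bvec (U := {:W}%VS) (col j (cokermx M2))^T).
    by apply: contra cj => /eqP/bvec_eq0/(congr1 trmx); rewrite trmxK trmx0 => ->.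
  move=> v; have [u ->] := bvecP (memvf v); rewrite -/(f psi _ _) E2 trmxK.
  by rewrite -mulmxA colE (mulmxA M2) mulmx_coker mul0mx mulmx0 mxE.
have dimV : (0 < \dim {:V})%N by rewrite lt0n dimv_eq0; case: Virr.
have [k /eigenvalueP[u uN u0]] := eigenvalue_closed (M1 *m pinvmx M2) dimV.
exists k.
pose chi x := phi x - k * psi x.
have chil c x y : chi (c *: x + y) = c * chi x + chi y.
  by rewrite /chi phil psil; ring.
suff chi0 : forall v w, chi (odd_pair v w) = 0.
  by move=> v w; apply/eqP; rewrite -subr_eq0; apply/eqP/chi0.
apply: odd_pair_degenerate_left => //.
exists (bvec (U := {:V}%VS) u); first by apply: contra u0 => /eqP/bvec_eq0 ->.
move=> w; have [y ->] := bvecP (memvf w); rewrite /chi -/(f phi _ _) -/(f psi _ _).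
have uM : u *m M1 = k *: (u *m M2).
  rewrite scalemxAl -uN -(mulmxA u) -(mulmxA M1).
  by rewrite mulVpmx // mulmx1.
by rewrite E1 E2 uM -scalemxAl mxE subrr.
Qed.

(** Pick a value [c] and a coordinate [phi j] nonzero on it. By Schur every coordinate of the
    pairing is a fixed multiple of the [j]-th, so every value is a multiple of [c]. *)
Lemma odd_pair_line : exists c : h, forall v w, exists k, odd_pair v w = k *: c.
Proof.
have [[v0 [w0 c0]]|all0] := pselect (exists v w, odd_pair v w <> 0); last first.
  exists 0 => v w; exists 0; rewrite scaler0.
  by apply: contrapT => vw0; apply: all0; exists v, w.
exists (odd_pair v0 w0); set c := odd_pair v0 w0 in c0 *.
pose X := vbasis {:h}%VS; pose phi j : h -> K := coord X j.
have phil j a x y : phi j (a *: x + y) = a * phi j x + phi j y by rewrite /phi linearP.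
have phi_inj x y : (forall j, phi j x = phi j y) -> x = y.
  move=> xy; rewrite (coord_vbasis (memvf x)) (coord_vbasis (memvf y)).
  by apply: eq_bigr => j _; rewrite [coord _ _ _]xy.
have [j cj] : exists j, phi j c != 0.
  apply: contrapT => no; apply: c0; apply: phi_inj => j; rewrite /phi linear0.
  by apply/eqP/negPn/negP => cj; apply: no; exists j.
move=> v w; exists (phi j (odd_pair v w) / phi j c); apply: phi_inj => l.
have [|k kE] := @odd_pair_schur (phi l) (phi j) (phil l) (phil j).
  by exists v0, w0.
rewrite [RHS](linZ (V := K^o) (phil l)) kE [phi l c]kE -/c.
by rewrite [RHS]mulrCA divfK.
Qed.

Lemma rank_ge3_even_realizable : (3 <= rk (cd_root i))%N -> even_realizable i.
Proof.
move=> rk3; apply: even_realizable_shift => x y hx hy.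
apply: contrapT => no; have [c cE] := odd_pair_line.
(* [t j] is the coefficient along [c] for the [j]-th basis vector of the odd part, so [[x, r y] = 0]
   for [r] with coordinates [u] in the kernel of [t]. Failure of the claim makes this kernel
   isotropic. *)
have [t tE] := choice (fun j : 'I_(\dim (odd_space h)) =>
  cE x (hm_act (vbasis (odd_space h))`_j y)).
move: rk3; rewrite ltnNge => /negP; apply; rewrite rk_odd_gram.
apply: (rank_isotropic_hyperplane (odd_gram_sym _) (t := \col_j t j)) => u ut.
apply/matrixP => j k; rewrite !ord1 [RHS]mxE -odd_gramE.
apply/eqP/negPn/negP => uu; apply: no; exists (odd_vec u).
have hu := odd_vec_homog u; split=> //.
rewrite -(odd_pair_neq hx); last exact: (hm_act_homog hu hy).
rewrite /odd_vec /bvec (lin_sum (fun c x y' => hm_act_linearl c x y' y)).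
rewrite (lin_sum (fun c => odd_pair_linearr c x)).
transitivity ((u *m \col_j t j) 0 0 *: c); last by rewrite ut mxE scale0r.
rewrite mxE scaler_suml; apply: eq_bigr => m _.
by rewrite actZl (linZ (fun c => odd_pair_linearr c x)) tE scalerA mxE.
Qed.

End OddCoroots.

(** * Irreducible modules over a Clifford algebra of rank 2 *)

Section CliffordRank2.
Local Open Scope ring_scope.
Context (K : numClosedFieldType) (h : finLieSuperType K).
Hypothesis hq : forall t x : h, homog false t -> lbr t x = 0.
Context (chi : h -> K).
Hypothesis chi_lin : forall c x y, chi (c *: x + y) = c * chi x + chi y.
Context (a b : h).
Hypotheses (ha : homog true a) (hb : homog true b).
Hypotheses (aa : chi (lbr a a) != 0) (bb : chi (lbr b b) != 0) (ab : chi (lbr a b) = 0).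
Hypothesis rad : forall u, homog true u -> chi (lbr u a) = 0 -> chi (lbr u b) = 0 ->
  forall x, homog true x -> chi (lbr u x) = 0.

(** [chi] will be [alpha] for [V], and [- alpha] for [W] and the dual of [V]. *)
Definition weight_module (M : hmodule h) : Prop :=
  irreducible_module M /\
  forall (t : h) (v : M), homog false t -> hm_act t v = chi t *: v.

Definition ab_eigen (J : K) (M : hmodule h) (v : M) : Prop :=
  [/\ homog false v, v != 0 & hm_act a (hm_act b v) = J *: v].

Let al := 2%:R^-1 * chi (lbr a a).
Let be := 2%:R^-1 * chi (lbr b b).

Let al0 : al != 0. Proof. by rewrite mulf_neq0 // invr_eq0 pnatr_eq0. Qed.

Section OneModule.
Context (M : hmodule h).
Hypothesis (wM : weight_module M).

Lemma weight_sqr (x : h) (v : M) : homog true x ->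
  hm_act x (hm_act x v) = (2%:R^-1 * chi (lbr x x)) *: v.
Proof.
move=> hx; rewrite act_odd_sqr // wM.2 ?scalerA //.
exact: (lbr_homog hx hx).
Qed.

Lemma act_ba (v : M) : hm_act b (hm_act a v) = - hm_act a (hm_act b v).
Proof.
apply/eqP; rewrite -addr_eq0 addrC -act_odd_lbr // wM.2 ?ab ?scale0r //.
exact: (lbr_homog ha hb).
Qed.

Lemma act_a_eq0 (v : M) : hm_act a v = 0 -> v = 0.
Proof.
move=> av; have := weight_sqr v ha; rewrite av act0r => /esym/eqP.
by rewrite scaler_eq0 (negPf al0) => /eqP.
Qed.

(** [(a b)^2 = - al be = J^2], so for nonzero even [u] either [a b u = J u] or [(a b - J) u] is an
    eigenvector for [- J]. *)
Lemma ab_eigen_exists J : J ^+ 2 = - (al * be) ->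
  exists v : M, ab_eigen J v \/ ab_eigen (- J) v.
Proof.
move=> JJ.
have [u hu u0] : exists2 u : M, homog false u & u != 0.
  have [/eqP nz _] := wM.1.
  have [m /eqP m0] : exists m : M, m <> 0.
    apply: contrapT => no; apply: nz; apply/eqP; rewrite -subv0; apply/subvP => m _.
    by rewrite memv0; apply/negPn/negP => /eqP m0; apply: no; exists m.
  have [e0|e0] := eqVneq (even_part m) 0; last first.
    by exists (even_part m) => //; apply: even_part_idem.
  (* When [m] is odd, [a m] is even, and nonzero because [a^2] is the nonzero scalar [al]. *)
  exists (hm_act a m); first by apply: (hm_act_homog ha (q := true)); apply/homog_oddE.
  by apply: contra m0 => /eqP/act_a_eq0 ->.
have hab : homog false (hm_act a (hm_act b u)).
  exact: (hm_act_homog ha (hm_act_homog hb hu)).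
have [E|E] := eqVneq (hm_act a (hm_act b u)) (J *: u); first by exists u; left.
exists (- J *: u + hm_act a (hm_act b u)); right; split.
- exact/homogD/hab/homogZ.
- by rewrite addrC scaleNr subr_eq0.
rewrite !hm_act_linearr.
set w := hm_act b u; have -> : hm_act a (hm_act b (hm_act a w)) = (J ^+ 2) *: u.
  rewrite act_ba -scaleN1r actZr weight_sqr // /w weight_sqr // !scalerA JJ.
  by congr (_ *: _); rewrite /al /be; ring.
by rewrite scalerDr scalerA mulrNN -expr2 addrC.
Qed.

Section Eigenvector.
Context (J : K) (v : M).
Hypothesis (hv : ab_eigen J v).

(** Apply [a] to [a b v = J v] and use [a^2 = al]. *)
Lemma ab_eigen_b : hm_act b v = (J / al) *: hm_act a v.
Proof.
have [_ _ abv] := hv.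
have : al *: hm_act b v = J *: hm_act a v by rewrite -(weight_sqr _ ha) abv actZr.
by move=> E; rewrite mulrC -scalerA -E scalerA mulVf // scale1r.
Qed.

(** With [coef_b], the coordinates of an odd [x] along [a], [b] modulo the radical of the form. *)
Definition coef_a (x : h) : K := chi (lbr x a) / chi (lbr a a).
Definition coef_b (x : h) : K := chi (lbr x b) / chi (lbr b b).

(** The remainder [k] of [x] after projection on [a], [b] lies in the radical, so it acts by zero by
    [odd_central_act0]. *)
Lemma act_two x (u : M) : homog true x ->
  hm_act x u = coef_a x *: hm_act a u + coef_b x *: hm_act b u.
Proof.
move=> hx; pose k := - coef_a x *: a + (- coef_b x *: b + x).
have hk : homog true k by apply/homogD/homogD => //; apply: homogZ.
have chik y : chi (lbr k y) =
    - coef_a x * chi (lbr a y) + (- coef_b x * chi (lbr b y) + chi (lbr x y)).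
  by rewrite /k !lbr_linearl !chi_lin.
have kk : forall y, homog true y -> chi (lbr k y) = 0.
  apply: rad => //; rewrite chik.
    by rewrite (lbr_odd_sym hb ha) ab mulr0 add0r mulNr divfK // addNr.
  by rewrite ab mulr0 add0r mulNr divfK // addNr.
have k0 (w : M) : hm_act k w = 0.
  apply: odd_central_act0 => //; first exact: wM.1.
    by move=> t ht; apply: hq.
  move=> y w' hy; rewrite wM.2; last exact: (lbr_homog hy hk).
  by rewrite lbr_odd_sym // kk // scale0r.
have xE : x = coef_a x *: a + (coef_b x *: b + k).
  by rewrite /k !scaleNr (addrCA (coef_b x *: b)) !addNKr.
by clearbody k; rewrite {1}xE !hm_act_linearl k0 addr0.
Qed.

Lemma ab_eigen_act x : homog true x ->
  hm_act x v = (coef_a x + coef_b x * (J / al)) *: hm_act a v /\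
  hm_act x (hm_act a v) = (coef_a x * al - coef_b x * J) *: v.
Proof.
move=> hx; have [_ _ abv] := hv; rewrite !(act_two _ hx); split.
  by rewrite ab_eigen_b scalerA scalerDl.
by rewrite (weight_sqr _ ha) act_ba abv scalerN !scalerA scalerBl.
Qed.

Lemma ab_eigen_span (z : M) : exists c d, z = c *: v + d *: hm_act a v.
Proof.
have [ev v0 abv] := hv; have oav := hm_act_homog ha ev.
apply: (irreducible_pred (S := fun z => exists c d, z = c *: v + d *: hm_act a v) wM.1).
- by exists 0, 0; rewrite !scale0r addr0.
- move=> k _ _ [c [d ->]] [c' [d' ->]]; exists (k * c + c'), (k * d + d').
  by rewrite scalerDr !scalerA !scalerDl addrACA.
- move=> _ [c [d ->]]; exists c, 0; rewrite scale0r addr0 even_partD.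
  rewrite [even_part (c *: v)](homogZ c ev).
  by have /homog_oddE -> := homogZ d oav; rewrite addr0.
- move=> x _ [c [d ->]]; elim/spart_ind: x => [x y [c1 [d1 E1]] [c2 [d2 E2]]|p x hx].
    exists (c1 + c2), (d1 + d2); rewrite actDl E1 E2.
    by rewrite addrACA -!scalerDl.
  rewrite actDr !actZr; case: p hx => hx.
    have [-> ->] := ab_eigen_act hx; rewrite !scalerA addrC.
    by eexists; eexists.
  by rewrite !(wM.2 x _ hx) !scalerA; eexists; eexists.
by exists v => //; exists 1, 0; rewrite scale1r scale0r addr0.
Qed.

Lemma ab_eigen_free : free [:: v; hm_act a v].
Proof.
have [ev v0 abv] := hv; have oav := hm_act_homog ha ev.
rewrite free_cons span_seq1 seq1_free; apply/andP; split.
  apply/vlineP => -[k vE]; case/eqP: v0; apply: homog_both => //.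
  by rewrite vE; apply: homogZ.
by apply: contra v0 => /eqP/act_a_eq0 ->.
Qed.

End Eigenvector.
End OneModule.

Lemma ab_eigen_hom J (M N : hmodule h) (v : M) (w : N) :
  weight_module M -> ab_eigen J v ->
  exists f : 'Hom(M, N), f v = w /\ f (hm_act a v) = hm_act a w.
Proof.
move=> wM hv.
have [f fE] := linear_of_free [:: v; hm_act a v] [:: w; hm_act a w].
have [E1 E2] := fE (ab_eigen_free wM hv) erefl.
by exists (linfun f); rewrite !lfunE /= E1 E2.
Qed.

(** In the bases [v, a v] and [w, a w] the odd elements act, by [ab_eigen_act], with the same
    structure constants, which depend only on the form and [J]. *)
Lemma ab_eigen_iso J (M N : hmodule h) (v : M) (w : N) :
  weight_module M -> weight_module N -> ab_eigen J v -> ab_eigen J w ->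
  module_iso M N.
Proof.
move=> wM wN hv hw.
have [f [fv fav]] := ab_eigen_hom w wM hv.
have [g [gw gaw]] := ab_eigen_hom v wN hw.
have fE c d : f (c *: v + d *: hm_act a v) = c *: w + d *: hm_act a w.
  by rewrite linearD !linearZ /= fv fav.
have [ev _ _] := hv; have [ew _ _] := hw.
exists f; split.
- exists g => z.
    have [c [d ->]] := ab_eigen_span wM hv z.
    by rewrite fE linearD !linearZ /= gw gaw.
  have [c [d ->]] := ab_eigen_span wN hw z.
  by rewrite [g _]linearD !linearZ /= gw gaw -fE linearD !linearZ.
- move=> z; have [c [d ->]] := ab_eigen_span wM hv z.
  have evenE (P : hmodule h) (u : P) : homog false u ->
      even_part (c *: u + d *: hm_act a u) = c *: u.
    move=> hu; rewrite even_partD [even_part (c *: u)](homogZ c hu).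
    by have /homog_oddE -> := homogZ d (hm_act_homog ha hu); rewrite addr0.
  by rewrite fE !evenE // linearZ /= fv.
move=> x z; have [c [d ->]] := ab_eigen_span wM hv z.
elim/spart_ind: x => [x y hx hy|p x hx]; first by rewrite !actDl linearD /= hx hy.
case: p hx => hx; last first.
  by rewrite wM.2 // wN.2 // linearZ.
rewrite fE !actDr !actZr.
have [-> ->] := ab_eigen_act wM hv hx; have [-> ->] := ab_eigen_act wN hw hx.
rewrite linearD !linearZ /= fv fav.
by congr (_ + _); rewrite !scalerA mulrC.
Qed.

End CliffordRank2.

(** * The type of rank 2 *)

Section Rank2.
Local Open Scope ring_scope.
Context (K : numClosedFieldType) (A : cartan_datum K) (i : cd_I A).
Local Notation h := (cd_h A).
Local Notation V := (@cd_g K A false i).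
Local Notation W := (@cd_g K A true i).
Local Notation Vdual := (dual_module (@cd_quasitoral K A) V).

(** [omega] is bijective, so [V] and its dual have the same submodules. *)
Lemma dual_irreducible : irreducible_module V -> irreducible_module Vdual.
Proof.
move=> [V0 Virr]; split=> // U [Uev Uact]; apply: Virr; split=> // x v vU.
by have := Uact (omega x) v vU; rewrite /= omegaK.
Qed.

Section OrthogonalPair.
Let l (x : h) : K := cd_root i x.
Let nl (x : h) : K := - l x.
Context (a b : h).
Hypotheses (ha : homog true a) (hb : homog true b).
Hypotheses (aa : l (lbr a a) != 0) (bb : l (lbr b b) != 0) (ab : l (lbr a b) = 0).
Hypothesis rad : forall u, homog true u -> l (lbr u a) = 0 -> l (lbr u b) = 0 ->
  forall x, homog true x -> l (lbr u x) = 0.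
Hypotheses (Virr : irreducible_module V) (Wirr : irreducible_module W).
Hypothesis not_iso : ~ module_iso W Vdual.

Let l_lin c x y : l (c *: x + y) = c * l x + l y.
Proof. by rewrite /l linearP. Qed.

Let nl_lin c x y : nl (c *: x + y) = c * nl x + nl y.
Proof. by rewrite /nl l_lin; ring. Qed.

Let naa : nl (lbr a a) != 0. Proof. by rewrite oppr_eq0. Qed.
Let nbb : nl (lbr b b) != 0. Proof. by rewrite oppr_eq0. Qed.
Let nab : nl (lbr a b) = 0. Proof. by rewrite /nl ab oppr0. Qed.

Let nrad u : homog true u -> nl (lbr u a) = 0 -> nl (lbr u b) = 0 ->
  forall x, homog true x -> nl (lbr u x) = 0.
Proof.
move=> hu /eqP; rewrite oppr_eq0 => /eqP ua /eqP; rewrite oppr_eq0 => /eqP ub x hx.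
by rewrite /nl rad // oppr0.
Qed.

Let wV : weight_module l V.
Proof. by split=> // t v ht; rewrite (cd_g_weight v ht) mul1r. Qed.

Let wW : weight_module nl W.
Proof. by split=> // t v ht; rewrite (cd_g_weight v ht) mulN1r. Qed.

Let wVdual : weight_module nl Vdual.
Proof.
split=> [|t v ht]; first exact: dual_irreducible.
by rewrite /= (omegaV_homog ht) scaleN1r -scaleN1r actZl wV.2 // scalerA mulN1r.
Qed.

(** With [al = alpha [a, a] / 2], [b v = (J / al) a v] but [b w = - (J / al) a w], as [W] has weight
    [- alpha]. Invariance under [a] and under [b] then equates the pairing of [a v] with [w] to both
    signs of that of [v] with [a w], so both vanish; the other basis pairs vanish by parity. *)
Lemma eigen_signs_agree J (v : V) (w : W) : J != 0 ->
  ab_eigen a b J v -> ab_eigen a b J w -> forall x y, @odd_pair K A i x y = 0.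
Proof.
move=> J0 hv hw.
have [ev _ _] := hv; have [ew _ _] := hw.
have oav := hm_act_homog ha ev; have oaw := hm_act_homog ha ew.
have PZl c x y : @odd_pair K A i (c *: x) y = c *: odd_pair x y.
  exact (linZ (fun c x x' => odd_pair_linearl c x x' _) c x).
have PZr c x y : @odd_pair K A i x (c *: y) = c *: odd_pair x y.
  exact (linZ (fun c => odd_pair_linearr c _) c y).
have Ea := odd_pair_invariant w ha ev; rewrite scale1r in Ea.
have Eb := odd_pair_invariant w hb ev; rewrite scale1r in Eb.
have vaw : odd_pair v (hm_act a w) = 0.
  move: Eb; rewrite (ab_eigen_b ha aa wV hv) (ab_eigen_b ha naa wW hw) PZl PZr Ea.
  rewrite /nl !mulrN invrN mulrN scaleNr opprK scalerN => /eqP.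
  rewrite -subr_eq0 -opprD oppr_eq0 -mulr2n -scaler_nat !scaler_eq0 pnatr_eq0 /=.
  rewrite mulf_eq0 (negPf J0) invr_eq0 mulf_eq0 invr_eq0 pnatr_eq0 (negPf aa) /=.
  by move/eqP.
have avw : odd_pair (hm_act a v) w = 0 by rewrite Ea vaw oppr0.
move=> x y.
have [c [d ->]] := ab_eigen_span (@cd_quasitoral K A) l_lin ha hb aa bb ab rad wV hv x.
have [c' [d' ->]] :=
  ab_eigen_span (@cd_quasitoral K A) nl_lin ha hb naa nbb nab nrad wW hw y.
rewrite odd_pair_linearl !odd_pair_linearr !PZl !PZr.
rewrite (odd_pair_same ev ew) (odd_pair_same oav oaw) vaw avw.
by rewrite !scaler0 !addr0 !scaler0.
Qed.

Lemma rank2_odd_pair_eq0 x y : @odd_pair K A i x y = 0.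
Proof.
pose c := 2%:R^-1 * l (lbr a a) * (2%:R^-1 * l (lbr b b)).
have [J JJ] : exists J : K, J ^+ 2 = - c by exists (sqrtC (- c)); rewrite sqrtCK.
have J0 : J != 0.
  have : J ^+ 2 != 0 by rewrite JJ oppr_eq0 !mulf_neq0 // invr_eq0 pnatr_eq0.
  by rewrite expf_eq0.
(* Both factors change sign with the weight, so the same [J] serves [V] and [W]. *)
have JJ' : J ^+ 2 = - (2%:R^-1 * nl (lbr a a) * (2%:R^-1 * nl (lbr b b))).
  by rewrite JJ /c /nl; ring.
have [v hv] := ab_eigen_exists ha hb aa ab wV JJ.
have [w hw] := ab_eigen_exists ha hb naa nab wW JJ'.
have NJ0 : - J != 0 by rewrite oppr_eq0.
(* On the dual [a] and [b] act as [- 'i a] and [- 'i b], so [a b] changes sign. *)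
have dual_eigen J' : ab_eigen a b J' v -> ab_eigen a b (- J') (v : Vdual).
  move=> [ev v0 E]; split=> //=.
  rewrite (omegaV_homog ha) (omegaV_homog hb) !actZl actZr E !scalerA.
  by rewrite mulrNN -expr2 sqrCi mulN1r.
have no J' : ab_eigen a b J' w -> ~ ab_eigen a b (- J') v.
  move=> hw' /dual_eigen; rewrite opprK => hv'; apply: not_iso.
  exact: (ab_eigen_iso (@cd_quasitoral K A) nl_lin ha hb naa nbb nab nrad wW wVdual
            hw' hv').
case: hv => hv; case: hw => hw.
- exact: (eigen_signs_agree J0 hv hw).
- by case: (no _ hw); rewrite opprK.
- by case: (no _ hw).
- exact: (eigen_signs_agree NJ0 hv hw).
Qed.

End OrthogonalPair.

Lemma he2Pi_even_realizable :
  clifford_kac_moody A -> type_he2Pi i -> even_realizable i.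
Proof.
move=> [irr _] [_ rk2 not_iso]; apply: even_realizable_shift => x y hx hy.
rewrite rk_odd_gram in rk2.
have [a [b [aa bb ab rad]]] := rank2_orthogonal (odd_gram_sym _) rk2.
have ha := odd_vec_homog a; have hb := odd_vec_homog b.
(* The odd pairing vanishes, so any non-isotropic [r] will do. *)
exists (odd_vec a); split=> //; first by rewrite odd_gramE.
rewrite -(odd_pair_neq hx); last exact: (hm_act_homog ha hy).
apply: (@rank2_odd_pair_eq0 (odd_vec a) (odd_vec b)) => //; rewrite ?odd_gramE //.
  by rewrite ab mxE.
move=> _ /odd_vecP[u ->]; rewrite !odd_gramE => ua ub _ /odd_vecP[w ->].
by rewrite odd_gramE rad ?mul0mx ?mxE //; apply/matrixP => j k;
  rewrite !ord1 [RHS]mxE.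
Qed.

End Rank2.

(** * The four types together *)

Theorem proposition6p1 (R : realType) (A : cartan_datum R[i]) (i : cd_I A) :
  clifford_kac_moody A ->
  [\/ type_he0 i, type_he0Pi i, type_he2Pi i |
      exists n : nat, (3 <= n)%N /\ type_H n i] ->
  (forall h : gA A, pure_coroot i h -> homog false h -> h <> 0%R ->
     exists e f : gA A,
       [/\ even_heisenberg_triple e h f, g_angle i e, g_angle i h & g_angle i f]) /\
  (forall j : cd_I A, brackets_vanish (coroot i) (root_space false j)).
Proof.
move=> ckm types.
have [hH hE] : heisenberg_type i /\ even_realizable i.
  case: types => [he0|he0Pi|he2Pi|[n [n3 [hH rkn]]]].
  - by split; [case: he0|apply: he0_even_realizable].
  - by split; [apply: he0Pi_heisenberg|apply: he0Pi_even_realizable].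
  - by split; [case: he2Pi|apply: he2Pi_even_realizable].
  split=> //; apply: rank_ge3_even_realizable; rewrite ?rkn //; exact: ckm.1.
by split=> [h|j]; [apply: even_pure_coroot_in_triple|apply: coroot_act0].
Qed.
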